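(* If $X$ is a connected locally finite (respectively countable) CW-complex, then $\Pi(X)$ is a locally finite (respectively countable) CW-complex, i.e. the topological space $\Pi(X)$ admits such a CW-complex structure.
   Context: A CW-complex is locally finite if every point is contained in a finite number of (closed) cells, and countable if it has countably many cells. For a path connected, locally path connected and semilocally simply connected space $X$ (for example a connected CW-complex), an open subset $U\subseteq X$ is nice if it is path connected and the inclusion induces the trivial map $\pi_1(U,x)\to\pi_1(X,x)$ for every $x\in U$; the nice open sets form a basis of the topology. Let $I=[0,1]$. $\Pi(X)$ is the set of homotopy classes relative to endpoints $[\gamma]$ of paths $\gamma:I\to X$, with the topology having as basis the sets $S(U,V,[\gamma])=\{[\delta_1*\gamma*\delta_2]\}$, where $U,V\subseteq X$ are nice open sets, $\gamma$ is a path with $\gamma(0)\in U$ and $\gamma(1)\in V$, and $\delta_1$ (resp. $\delta_2$) ranges over the paths contained in $U$ ending at $\gamma(0)$ (resp. contained in $V$ starting at $\gamma(1)$); $*$ is concatenation.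
   Formalization: ''Locally finite'' is taken as: every point has a neighbourhood meeting only finitely many closed cells; with ''every point is contained in a finite number of closed cells'' the claim fails for [0,1] with a 2-cell attached by a constant map at each interior point. *)

(* Defs.v *)
From HB Require Import structures.
From mathcomp Require Import all_boot all_order all_algebra.
From mathcomp Require Import all_classical all_reals all_analysis.

Set Implicit Arguments.
Unset Strict Implicit.
Unset Printing Implicit Defensive.

Import Order.TTheory GRing.Theory Num.Theory.
Import numFieldNormedType.Exports.

Local Open Scope classical_set_scope.
Local Open Scope ring_scope.

(* The norm of 'rV[R]_n is the sup norm, so Euclidean balls are spelled out. *)
Definition closed_disk (R : realType) (n : nat) : set 'rV[R]_n :=
  [set v | \sum_(i < n) v ord0 i ^+ 2 <= 1].

Definition open_disk (R : realType) (n : nat) : set 'rV[R]_n :=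
  [set v | \sum_(i < n) v ord0 i ^+ 2 < 1].

Definition sphere (R : realType) (n : nat) : set 'rV[R]_n :=
  [set v | \sum_(i < n) v ord0 i ^+ 2 = 1].

Arguments closed_disk : clear implicits.
Arguments open_disk : clear implicits.
Arguments sphere : clear implicits.

(* Whitehead's definition. Only the restriction of the characteristic map     *)
(* [cw_char e] to the closed disk is relevant.                                *)
Record cw_complex (R : realType) (T : topologicalType) := CWComplex {
  cw_cell : Type ;
  cw_dim : cw_cell -> nat ;
  cw_char : forall e : cw_cell, 'rV[R]_(cw_dim e) -> T ;
  cw_hausdorff : hausdorff_space T ;
  cw_char_continuous : forall e,
    {within closed_disk R (cw_dim e), continuous (@cw_char e)} ;
  (* the next two fields: [cw_char e] is a homeomorphism from the open disk
     onto the open cell *)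
  cw_char_inj : forall e, set_inj (open_disk R (cw_dim e)) (@cw_char e) ;
  cw_char_open : forall e (O : set 'rV[R]_(cw_dim e)), open O ->
    exists2 V : set T, open V &
      @cw_char e @` (O `&` open_disk R (cw_dim e)) =
      V `&` (@cw_char e @` open_disk R (cw_dim e)) ;
  cw_partition : forall x : T,
    exists! e, (@cw_char e @` open_disk R (cw_dim e)) x ;
  cw_closure_finite : forall e, exists F : set cw_cell,
    [/\ finite_set F,
        (forall e', F e' -> (cw_dim e' < cw_dim e)%N) &
        @cw_char e @` sphere R (cw_dim e) `<=`
          \bigcup_(e' in F) (@cw_char e' @` open_disk R (cw_dim e'))] ;
  cw_weak_topology : forall A : set T,
    (forall e, closed (A `&` (@cw_char e @` closed_disk R (cw_dim e)))) ->
    closed A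
}.

Arguments cw_cell {R T} _.
Arguments cw_dim {R T _} _.
Arguments cw_char {R T _} _ _.

Definition closed_cell (R : realType) (T : topologicalType)
    (C : cw_complex R T) (e : cw_cell C) : set T :=
  cw_char e @` closed_disk R (cw_dim e).

(* The neighbourhood matters. If every closed cell is a subcomplex, it is     *)
(* equivalent to ask that each point be in finitely many closed cells, but in *)
(* general this is weaker: the interval [0, 1] with a 2-cell attached by a    *)
(* constant map at each interior point is such a complex X that is not        *)
(* locally compact, and X * X, to which Pi(X) is then homeomorphic, is not    *)
(* compactly generated, hence not a CW-complex.                               *)
Definition cw_locally_finite (R : realType) (T : topologicalType)
    (C : cw_complex R T) :=
  forall x : T, exists2 U : set T, nbhs x U &
    finite_set [set e : cw_cell C | closed_cell e `&` U !=set0].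

Lemma cw_locally_finite_point (R : realType) (T : topologicalType)
    (C : cw_complex R T) : cw_locally_finite C ->
  forall x, finite_set [set e : cw_cell C | closed_cell e x].
Proof.
move=> lfC x; have [U xU fU] := lfC x.
by apply: sub_finite_set fU => e ex; exists x; split => //; exact: nbhs_singleton.
Qed.

Definition cw_countable (R : realType) (T : topologicalType)
    (C : cw_complex R T) := countable [set: cw_cell C].

Section paths.
Context (R : realType) (X : topologicalType).
Implicit Types (g h : R -> X) (U V : set X).

Definition unit_itv : set R := `[0%R, 1%R].

(* Paths are functions on R of which only the restriction to [0, 1] matters. *)
Definition is_path g := {within unit_itv, continuous g}.

Definition path_in U g := is_path g /\ g @` unit_itv `<=` U.

Definition path_homotopic g h := exists H : R * R -> X,
  [/\ {within unit_itv `*` unit_itv, continuous H},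
      (forall t, unit_itv t -> H (t, 0) = g t),
      (forall t, unit_itv t -> H (t, 1) = h t) &
      (forall s, unit_itv s -> H (0, s) = g 0 /\ H (1, s) = g 1)].

Definition path_concat g h : R -> X :=
  fun t => if t <= 2^-1 then g (2 * t) else h (2 * t - 1).

Definition path_class g : set (R -> X) := [set h | path_homotopic g h].

Definition path_connected U := forall x y, U x -> U y ->
  exists g, [/\ path_in U g, g 0 = x & g 1 = y].

Definition pi1_trivial_in U := forall x g,
  path_in U g -> g 0 = x -> g 1 = x -> path_homotopic g (cst x).

Definition nice U := [/\ open U, path_connected U & pi1_trivial_in U].

Definition Pi := {c : set (R -> X) | exists2 g, is_path g & c = path_class g}.

HB.instance Definition _ := gen_eqMixin Pi.
HB.instance Definition _ := gen_choiceMixin Pi.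

Definition Pi_basic U V g : set Pi :=
  [set c | exists d1 d2,
    [/\ path_in U d1 /\ d1 1 = g 0, path_in V d2 /\ d2 0 = g 1 &
        sval c = path_class (path_concat (path_concat d1 g) d2)]].

Definition Pi_basis : set (set Pi) :=
  [set S | exists U V g,
    [/\ nice U /\ nice V, is_path g, U (g 0), V (g 1) & S = Pi_basic U V g]].

(* The topology generated by [Pi_basis]. When the nice open sets form a basis *)
(* of X, [Pi_basis] is a basis of it and not only a subbasis.                 *)
HB.instance Definition _ := isSubBaseTopological.Build Pi Pi_basis id.

End paths.

(* Main.v *)
(** A locally finite connected complex is countable, so assume that X has countably
    many cells. They can be attached one at a time, and growing a small ball
    through radial collars of the successive cells yields a basis of nice open
    sets; hence Pi(X) -> X * X is a covering, whose sheets are translates of a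
    class by short paths. Since X is the union of an increasing sequence of
    compact sets defining its topology, X * X carries the weak topology of the
    products of cells (Milnor). The cells of Pi(X) are the lifts of these
    products: triples of two cells e, f and a class c of paths from the center of
    e to the center of f. Two centers are compared through the common points of
    the closed cells, and by compactness of the disks only finitely many classes
    arise in this way from two given cells; this gives closure finiteness and
    local finiteness. The classes generated by the comparisons form a countable
    set, and the lifted cells they index form an open and closed subset of Pi(X)
    which is everything, whence the countability. *)

Require Import Defs.
From Stdlib Require Wf_nat.
From mathcomp Require Import all_boot all_order all_algebra.
From mathcomp Require Import all_classical all_reals all_analysis.
From mathcomp Require Import finmap zify lra ring.
Set Implicit Arguments.
Unset Strict Implicit.
Unset Printing Implicit Defensive.
Import Order.TTheory GRing.Theory Num.Theory.
Import numFieldNormedType.Exports.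
Local Open Scope classical_set_scope.
Local Open Scope ring_scope.

(** * Continuity within a set, and compactness *)

(** A point of a closed cell may have many preimages in the disk, and the segments joining them to
    the center need not have homotopic images. Comparing two centers is therefore multivalued: what
    can be proved is that the class is locally constant on the compact set of pairs of preimages,
    and finiteness replaces uniqueness. Identities between classes of paths are reduced to one
    computation. A class is presented as the image of a segment under a map continuous on a convex
    set, and such classes compose like pairs of points. The convex set is [0, 1] for the groupoid
    laws, a square for deformations and the disk for cells. Statements about a cell are proved in
    its disk and pushed down: a map from a compact space to a Hausdorff one is closed, so what holds
    near every preimage of a point holds near that point. In the growth of a nice set it is the
    closure that has to stay in the given open set: the attaching map of the next cell is arbitrary,
    and a collar of uniform width exists only over a compact part of its sphere. *)

(** The point [x] need not lie in [A]. This makes pasting easy: [cont_at_out] settles a closed piece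
    that misses [x], and [cont_atU] joins the pieces. *)
Definition cont_at (T S : topologicalType) (A : set T) (f : T -> S) (x : T) :=
  forall N, nbhs (f x) N -> \forall y \near x, A y -> N (f y).

Definition cont_on (T S : topologicalType) (A : set T) (f : T -> S) :=
  forall x, A x -> cont_at A f x.

Lemma lt_nbhsr (R : realFieldType) (x a : R) : a < x -> \forall y \near x, a < y.
Proof.
move=> ax; have : - x < - a by rewrite ltrN2.
move=> /lt_nbhsl h.
have : \forall y \near x, - y < - a := @opp_continuous R x _ h.
by apply: filterS => y /=; rewrite ltrN2.
Qed.

Section ContOn.
Context {T S W : topologicalType}.
Implicit Types (A B : set T) (f : T -> S) (x : T).

Lemma cont_onP A f : {within A, continuous f} <-> cont_on A f.
Proof. exact: subspace_continuousP. Qed.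

Lemma continuous_cont_on A f : continuous f -> cont_on A f.
Proof.
move=> cf x _ N xN; have : \forall y \near x, N (f y) := cf x N xN.
by apply: filterS => y h _. Qed.

Lemma continuous_cont_at A f x : {for x, continuous f} -> cont_at A f x.
Proof.
move=> cf N xN; have : \forall y \near x, N (f y) := cf N xN.
by apply: filterS => y h _. Qed.

Lemma cont_atS A B f x : A `<=` B -> cont_at B f x -> cont_at A f x.
Proof. by move=> AB cf N /cf; apply: filterS => y h /AB. Qed.

Lemma cont_onS A B f : A `<=` B -> cont_on B f -> cont_on A f.
Proof. by move=> AB cf x /AB /cf; exact: cont_atS. Qed.

Lemma cont_at_eq A f g x : f x = g x -> {in A, f =1 g} ->
  cont_at A f x -> cont_at A g x.
Proof.
move=> fgx fg cf N; rewrite -fgx => /cf; apply: filterS => y h Ay.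
by rewrite -fg ?in_setE //; apply: h.
Qed.

Lemma cont_on_eq A f g : {in A, f =1 g} -> cont_on A f -> cont_on A g.
Proof.
move=> fg cf x Ax; apply: (cont_at_eq (f := f)) => //; last exact: cf.
by apply: fg; rewrite in_setE.
Qed.

Lemma cont_at_comp A (B : set S) f (g : S -> W) x :
  (forall y, A y -> B (f y)) -> cont_at A f x -> cont_at B g (f x) ->
  cont_at A (g \o f) x.
Proof.
move=> AB cf cg N /cg /cf; apply: filterS => y h Ay.
by apply: h => //; exact: AB.
Qed.

Lemma cont_on_comp A (B : set S) f (g : S -> W) :
  (forall y, A y -> B (f y)) -> cont_on A f -> cont_on B g ->
  cont_on A (g \o f).
Proof.
by move=> AB cf cg x Ax; apply: (cont_at_comp AB); [exact: cf|exact/cg/AB].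
Qed.

Lemma cont_at_pair A f (g : T -> W) x : cont_at A f x -> cont_at A g x ->
  cont_at A (fun y => (f y, g y)) x.
Proof.
move=> cf cg N [[P Q] /= [/cf nP /cg nQ] PQN].
by near=> y => Ay; apply: PQN; split => /=; [apply: (near nP y)|apply: (near nQ y)].
Unshelve. all: by end_near. Qed.

(* A continuous map from a compact space to a Hausdorff space is closed: what
   holds near a fiber holds on the nearby fibers. *)
Lemma compact_fiber_near (K : set T) (q : T -> S) (y : S) (P : T -> Prop) :
  hausdorff_space S -> compact K -> cont_on K q ->
  (forall k, K k -> q k = y -> \forall k' \near k, K k' -> P k') ->
  \forall z \near y, forall k, K k -> q k = z -> P k.
Proof.
move=> hS /compact_near_coveringP/near_covering_withinP cK cq cP.
suff : \forall z \near y, K `<=` (fun k => q k = z -> P k) by [].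
apply: cK => k Kk.
have [qky|/eqP qky] := pselect (q k = y).
  have nk := cP k Kk qky.
  by near=> k' z; move=> /= Kk' _; apply: (near nk k').
move: hS; rewrite open_hausdorff => /(_ _ _ qky) [[U V] /=].
move=> [/set_mem Uqk /set_mem Vy] [oU oV /eqP UV0].
have nU := cq k Kk _ (open_nbhs_nbhs (conj oU Uqk)).
have nV := open_nbhs_nbhs (conj oV Vy).
near=> k' z; move=> /= Kk' k'z; exfalso.
suff : (U `&` V) z by rewrite UV0.
by split; [rewrite -k'z; apply: (near nU k')|apply: (near nV z)].
Unshelve. all: by end_near. Qed.

(** A compact set maps to its image in a Hausdorff space by a quotient map, so continuity at [y] can
    be tested along the fiber over [y]. *)
Lemma compact_quotient_cont_at (K : set T) (q : T -> S) (f : S -> W) (y : S) :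
  hausdorff_space S -> compact K -> cont_on K q ->
  (forall k, K k -> q k = y -> cont_at K (f \o q) k) ->
  cont_at (q @` K) f y.
Proof.
move=> hS cK cq cf N yN.
have := @compact_fiber_near K q y (fun k => N (f (q k))) hS cK cq.
have : forall k, K k -> q k = y -> \forall k' \near k, K k' -> N (f (q k')).
  by move=> k Kk qky; apply: (cf k Kk qky N); rewrite /= qky.
move=> /[swap] /[apply]; apply: filterS => z h [k Kk kz].
by rewrite -kz; exact: h kz.
Qed.

Lemma cont_on_compact A f : cont_on A f -> compact A -> compact (f @` A).
Proof. by move=> /cont_onP; exact: continuous_compact. Qed.

Lemma cont_atU A B f x :
  cont_at A f x -> cont_at B f x -> cont_at (A `|` B) f x.
Proof.
move=> cA cB N xN; have nA := cA N xN; have nB := cB N xN.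
by near=> y => -[Ay|By]; [apply: (near nA y)|apply: (near nB y)].
Unshelve. all: by end_near. Qed.

Lemma cont_at_out A f x : closed A -> ~ A x -> cont_at A f x.
Proof.
move=> cA nAx N _.
have : nbhs x (~` A) by apply: open_nbhs_nbhs; split => //; exact: closed_openC.
by apply: filterS.
Qed.

Lemma cont_at_paste (R : realType) A f x (phi : T -> R) (c : R) :
  {for x, continuous phi} ->
  (phi x <= c -> cont_at (A `&` [set y | phi y <= c]) f x) ->
  (c <= phi x -> cont_at (A `&` [set y | c <= phi y]) f x) ->
  cont_at A f x.
Proof.
move=> cphi c1 c2 N xN.
have [lt|gt|eq] := ltgtP (phi x) c.
- have n1 := c1 (ltW lt) N xN.
  have n2 : \forall y \near x, phi y < c by exact: (cphi _ (lt_nbhsl lt)).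
  by near=> y => Ay; apply: (near n1 y) => //; split => //=;
     apply: ltW; apply: (near n2 y).
- have n1 := c2 (ltW gt) N xN.
  have n2 : \forall y \near x, c < phi y by exact: (cphi _ (lt_nbhsr gt)).
  by near=> y => Ay; apply: (near n1 y) => //; split => //=;
     apply: ltW; apply: (near n2 y).
- have n1 := c1 _ N xN; have n2 := c2 _ N xN.
  move: n1 n2; rewrite eq lexx => /(_ isT) n1 /(_ isT) n2.
  near=> y => Ay; have [yc|yc] := leP (phi y) c; first by apply: (near n1 y).
  by apply: (near n2 y) => //; split => //=; exact: ltW.
Unshelve. all: by end_near. Qed.

End ContOn.

Lemma cont_on_fst (T S : topologicalType) (A : set (T * S)) : cont_on A fst.
Proof. by apply: continuous_cont_on => x; exact: cvg_fst. Qed.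

Lemma cont_on_snd (T S : topologicalType) (A : set (T * S)) : cont_on A snd.
Proof. by apply: continuous_cont_on => x; exact: cvg_snd. Qed.

Lemma cont_at_fst (T S : topologicalType) (A : set (T * S)) x : cont_at A fst x.
Proof. by apply: continuous_cont_at; exact: cvg_fst. Qed.

Lemma cont_at_snd (T S : topologicalType) (A : set (T * S)) x : cont_at A snd x.
Proof. by apply: continuous_cont_at; exact: cvg_snd. Qed.

Lemma hausdorff_prod (T S : topologicalType) :
  hausdorff_space T -> hausdorff_space S -> hausdorff_space (T * S)%type.
Proof.
move=> hT hS [a b] [c d] cl; congr pair.
- apply: hT => A B Aa Bc.
  have [|[x y] [Ax Bx]] := cl (fst @^-1` A) (fst @^-1` B) (@cvg_fst _ _ _ _ _ A Aa).
    exact: (@cvg_fst _ _ _ _ _ B Bc).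
  by exists x.
- apply: hS => A B Ab Bd.
  have [|[x y] [Ay By]] := cl (snd @^-1` A) (snd @^-1` B) (@cvg_snd _ _ _ _ _ A Ab).
    exact: (@cvg_snd _ _ _ _ _ B Bd).
  by exists y.
Qed.

Lemma cont_on_closed (T S : topologicalType) (D : set T) (f : T -> S) (Z : set S) :
  closed D -> cont_on D f -> closed Z -> closed (D `&` f @^-1` Z).
Proof.
move=> cD cf cZ; rewrite -openC openE => x nx; rewrite /interior.
have [Dx|Dx] := pselect (D x); last first.
  by apply: filterS (open_nbhs_nbhs (conj (closed_openC cD) Dx)) => y Dy [].
have fx : (~` Z) (f x) by move=> Zfx; apply: nx.
have := cf x Dx _ (open_nbhs_nbhs (conj (closed_openC cZ) fx)).
by apply: filterS => y h [/h].
Qed.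

(** * Path homotopy and the fundamental groupoid *)

Section Line.
Context {R : realType} {V : normedModType R}.
Implicit Types (a b c : V) (D : set V).

Definition line a b (t : R) : V := (1 - t) *: a + t *: b.

Definition convex D := forall a b t, D a -> D b -> unit_itv t -> D (line a b t).

Lemma line0 a b : line a b 0 = a.
Proof. by rewrite /line subr0 scale1r scale0r addr0. Qed.

Lemma line1 a b : line a b 1 = b.
Proof. by rewrite /line subrr scale0r scale1r add0r. Qed.

Lemma lineaa a t : line a a t = a.
Proof. by rewrite /line -scalerDl subrK scale1r. Qed.

Lemma convex_ball a (r : R) : convex (ball a r).
Proof.
move=> b c t; rewrite -ball_normE /ball_ /= => ab ac.
rewrite /unit_itv /= in_itv /= => /andP[t0 t1].
have -> : a - line b c t = (1 - t) *: (a - b) + t *: (a - c).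
  rewrite /line !scalerBr opprD addrACA; congr (_ + _).
  by rewrite -scalerDl subrK scale1r.
apply: le_lt_trans (ler_normD _ _) _; rewrite !normrZ.
rewrite (ger0_norm t0) (ger0_norm (x := 1 - t)) ?subr_ge0//.
(* The strict inequality comes from the term of weight [t], so [t = 0] is treated apart. *)
have [->|tn0] := eqVneq t 0; first by rewrite mul0r addr0 subr0 mul1r.
have -> : r = (1 - t) * r + t * r by rewrite -mulrDl subrK mul1r.
by apply: ler_ltD; [rewrite ler_wpM2l ?subr_ge0// ltW|
  rewrite ltr_pM2l// lt_def tn0].
Qed.

Lemma cont_at_line (T : topologicalType) (A : set T) (a b : T -> V) (t : T -> R) x :
  cont_at A a x -> cont_at A b x -> cont_at A t x ->
  cont_at A (fun y => line (a y) (b y) (t y)) x.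
Proof.
move=> ca cb ct; rewrite /cont_at.
apply: (@cvgD _ _ _ (within A (nbhs x))).
  apply: (@cvgZ _ _ _ (within A (nbhs x))) => //.
  by apply: (@cvgB _ R^o _ (within A (nbhs x))) => //; exact: cvg_cst.
exact: (@cvgZ _ _ _ (within A (nbhs x))).
Qed.

End Line.

Section Homotopy.
Context {R : realType} {X : topologicalType}.
Implicit Types g h k : R -> X.
Local Notation I := (@unit_itv R).

Lemma unit_itvE (t : R) : I t = (0 <= t <= 1).
Proof. by rewrite /unit_itv /= in_itv. Qed.

Lemma is_pathP g : is_path g <-> cont_on I g.
Proof. exact: cont_onP. Qed.

(** The straight-line homotopy inside [D]. The groupoid laws and the composition of segments rest on
    it. *)
Lemma convex_homotopic (V : normedModType R) (D : set V) (Phi : V -> X)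
    (a b : R -> V) :
  convex D -> cont_on D Phi -> cont_on I a -> cont_on I b ->
  (forall t, I t -> D (a t)) -> (forall t, I t -> D (b t)) ->
  a 0 = b 0 -> a 1 = b 1 -> path_homotopic (Phi \o a) (Phi \o b).
Proof.
move=> cD cPhi ca cb Da Db ab0 ab1.
exists (fun p => Phi (line (a p.1) (b p.1) p.2)); split => /=.
- apply/cont_onP/(cont_on_comp (B := D)) => //.
    by move=> [t s] [/= It Is]; apply: cD => //; [exact: Da|exact: Db].
  have cf (A : set (R * R)) p : cont_at A fst p.
    exact: cont_at_fst.
  have cs (A : set (R * R)) p : cont_at A snd p.
    exact: cont_at_snd.
  move=> p [/= It Is]; apply: cont_at_line => //.
  + by apply: (cont_at_comp (B := I)) => //; [by move=> y []|exact: ca].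
  + by apply: (cont_at_comp (B := I)) => //; [by move=> y []|exact: cb].
- by move=> t _; rewrite line0.
- by move=> t _; rewrite line1.
- by move=> s _; rewrite ab0 ab1 !lineaa.
Qed.

Lemma path_homotopic_eq g h : is_path g -> {in I, g =1 h} -> path_homotopic g h.
Proof.
move=> /is_pathP cg gh; exists (g \o fst); split => //=.
- apply/cont_onP/(cont_on_comp (B := I)) => //; first by move=> ? [].
  exact: cont_on_fst.
- by move=> t It; apply: gh; rewrite in_setE.
Qed.

Lemma path_homotopic_refl g : is_path g -> path_homotopic g g.
Proof. by move=> /path_homotopic_eq; apply. Qed.

Lemma path_homotopic_ends g h :
  path_homotopic g h -> h 0 = g 0 /\ h 1 = g 1.
Proof.
have I0 : I 0 by rewrite unit_itvE lexx ler01.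
have I1 : I 1 by rewrite unit_itvE lexx ler01.
by move=> [H [_ H0 H1 /(_ _ I1)[e0 e1]]]; rewrite -H1// -H1.
Qed.

Lemma path_homotopic_sym g h : path_homotopic g h -> path_homotopic h g.
Proof.
move=> gh; have [h0 h1] := path_homotopic_ends gh.
move: gh => [H [/cont_onP cH H0 H1 Hs]].
exists (fun p => H (p.1, 1 - p.2)); split => /=.
- apply/cont_onP/(cont_on_comp (B := I `*` I)) => //.
    by move=> [t s] [/=]; rewrite !unit_itvE => ? ?; split => /=;
      rewrite ?unit_itvE; lra.
  move=> p _; apply: cont_at_pair; first exact: cont_at_fst.
  apply: continuous_cont_at; apply: (@cvgB _ R^o); first exact: cvg_cst.
  exact: cvg_snd.
- by move=> t It; rewrite subr0 H1.
- by move=> t It; rewrite subrr H0.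
- move=> s; rewrite h0 h1 unit_itvE => s01; apply: Hs.
  by rewrite ?unit_itvE; lra.
Qed.

Lemma cont_on_affine (T : topologicalType) (A : set T) (f : T -> R) (c d : R) :
  cont_on A f -> cont_on A (fun x => c * f x + d).
Proof.
move=> cf x Ax.
apply: (@cvgD _ R^o _ (within A (nbhs x))); last exact: cvg_cst.
apply: (@cvgM _ _ (within A (nbhs x))); [exact: cvg_cst|exact: cf].
Qed.

Lemma path_homotopic_trans g h k :
  path_homotopic g h -> path_homotopic h k -> path_homotopic g k.
Proof.
move=> gh; have [h0 h1] := path_homotopic_ends gh.
move: gh => [H [/cont_onP cH H0 H1 Hs]] [K [/cont_onP cK K0 K1 Ks]].
(* Both branches have the form [2 * s + d] so that [cont_on_affine] applies. *)
exists (fun p => if p.2 <= 2^-1 then H (p.1, 2 * p.2 + 0) else K (p.1, 2 * p.2 + -1)).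
split => /=.
- apply/cont_onP => -[t s] [/= It Is].
  apply: (@cont_at_paste _ _ _ _ _ _ snd 2^-1); first exact: cvg_snd.
  + rewrite /= => s2.
    apply: (@cont_at_eq _ _ _ (fun p : R * R => H (p.1, 2 * p.2 + 0))).
    * by rewrite s2.
    * by move=> [t' s'] => /set_mem[_ /= ->].
    * apply: (@cont_on_comp _ _ _ _ (I `*` I)
        (fun p : R * R => (p.1, 2 * p.2 + 0))
        H _ _ _ (t, s)) => //; last first.
      - by move=> p ?; apply: cont_at_pair;
          [exact: cont_at_fst|
           apply: cont_on_affine => //; exact: cont_on_snd].
      - by move=> [t' s'] [[/= It' +] +]; rewrite /= !unit_itvE => *;
          split => //=; rewrite ?unit_itvE; lra.
  + rewrite /= => s2.
    apply: (@cont_at_eq _ _ _ (fun p : R * R => K (p.1, 2 * p.2 + -1))).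
    * case: ifPn => // s2'; have -> : s = 2^-1 by apply/le_anti/andP.
      rewrite divff// subrr addr0 K0// H1//.
    * move=> [t' s'] => /set_mem[[/= It' Is'] /= s2'].
      case: ifPn => // s2''; have -> : s' = 2^-1 by apply/le_anti/andP.
      by rewrite divff// subrr addr0 K0// H1.
    * apply: (@cont_on_comp _ _ _ _ (I `*` I)
        (fun p : R * R => (p.1, 2 * p.2 + -1))
        K _ _ _ (t, s)) => //; last first.
      - by move=> p ?; apply: cont_at_pair;
          [exact: cont_at_fst|
           apply: cont_on_affine => //; exact: cont_on_snd].
      - by move=> [t' s'] [[/= It' +] +]; rewrite /= !unit_itvE => *;
          split => //=; rewrite ?unit_itvE; lra.
- by move=> t It; rewrite ifT ?invr_ge0// mulr0 addr0 H0.
- move=> t It; rewrite ifF; last by apply/negbTE; rewrite -ltNge; lra.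
  by rewrite -K1//; congr (K (_, _)); lra.
- move=> s; rewrite unit_itvE => Is.
  case: ifPn => [s2|]; first by apply: Hs; rewrite ?unit_itvE; lra.
  by rewrite -ltNge => s2; rewrite -h0 -h1; apply: Ks; rewrite ?unit_itvE; lra.
Qed.

Lemma path_homotopic_is_path g h : path_homotopic g h -> is_path h.
Proof.
move=> [H [/cont_onP cH _ H1 _]]; apply/is_pathP.
have I1 : I 1 by rewrite unit_itvE lexx ler01.
apply: (@cont_on_eq _ _ _ (H \o (fun t => (t, 1)))).
  by move=> t /set_mem It /=; rewrite H1.
apply: (cont_on_comp (B := I `*` I)) => //.
by move=> t _; apply: cont_at_pair; apply: continuous_cont_at;
  [exact: cvg_id|exact: cvg_cst].
Qed.

Lemma path_concat_homotopic g g' h h' : g 1 = h 0 ->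
  path_homotopic g g' -> path_homotopic h h' ->
  path_homotopic (path_concat g h) (path_concat g' h').
Proof.
move=> gh [H [/cont_onP cH H0 H1 Hs]] [K [/cont_onP cK K0 K1 Ks]].
exists (fun p => if p.1 <= 2^-1 then H (2 * p.1 + 0, p.2) else K (2 * p.1 + -1, p.2)).
have I0 : I 0 by rewrite unit_itvE lexx ler01.
have I1 : I 1 by rewrite unit_itvE lexx ler01.
split => /=.
- apply/cont_onP => -[s t] [/= Is It].
  have e u : I u -> K (2 * 2^-1 + -1, u) = H (2 * 2^-1 + 0, u).
    move=> Iu; rewrite divff// subrr addr0.
    by have [_ ->] := Hs _ Iu; have [-> _] := Ks _ Iu.
  apply: (@cont_at_paste _ _ _ _ _ _ fst 2^-1); first exact: cvg_fst.
  + rewrite /= => s2.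
    apply: (@cont_at_eq _ _ _ (fun p : R * R => H (2 * p.1 + 0, p.2))).
    * by rewrite s2.
    * by move=> [t' s'] => /set_mem[_ /= ->].
    * apply: (@cont_on_comp _ _ _ _ (I `*` I)
        (fun p : R * R => (2 * p.1 + 0, p.2))
        H _ _ _ (s, t)) => //; last first.
      - by move=> p ?; apply: cont_at_pair;
          [apply: cont_on_affine => //; exact: cont_on_fst|
           exact: cont_at_snd].
      - by move=> [t' s'] [[/= + It'] +]; rewrite /= !unit_itvE => *;
          split => //=; rewrite ?unit_itvE; lra.
  + rewrite /= => s2.
    apply: (@cont_at_eq _ _ _ (fun p : R * R => K (2 * p.1 + -1, p.2))).
    * case: ifPn => // s2'; have -> : s = 2^-1 by apply/le_anti/andP.
      exact: (e _ It).
    * move=> [s' t'] => /set_mem[[/= Is' It'] /= s2'].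
      case: ifPn => // s2''; have -> : s' = 2^-1 by apply/le_anti/andP.
      exact: (e _ It').
    * apply: (@cont_on_comp _ _ _ _ (I `*` I)
        (fun p : R * R => (2 * p.1 + -1, p.2))
        K _ _ _ (s, t)) => //; last first.
      - by move=> p ?; apply: cont_at_pair;
          [apply: cont_on_affine => //; exact: cont_on_fst|
           exact: cont_at_snd].
      - by move=> [t' s'] [[/= + It'] +]; rewrite /= !unit_itvE => *;
          split => //=; rewrite ?unit_itvE; lra.
- move=> t; rewrite /path_concat unit_itvE => It; case: ifPn => [t2|]; rewrite ?addr0.
    by rewrite H0// unit_itvE; lra.
  by rewrite -ltNge => t2; rewrite K0// unit_itvE; lra.
- move=> t; rewrite /path_concat unit_itvE => It; case: ifPn => [t2|]; rewrite ?addr0.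
    by rewrite H1// unit_itvE; lra.
  by rewrite -ltNge => t2; rewrite K1// unit_itvE; lra.
- move=> s Is; rewrite /path_concat.
  have -> : (0 <= 2^-1 :> R) by rewrite invr_ge0.
  have -> : (1 <= 2^-1 :> R) = false by apply/negbTE; rewrite -ltNge; lra.
  rewrite !mulr0 addr0 mulr1.
  have -> : 2 - 1 = 1 :> R by lra.
  by have [-> _] := Hs _ Is; have [_ ->] := Ks _ Is.
Qed.

(** The constant homotopies of [g] and [h] concatenate to a homotopy, and the end of a homotopy is a
    path. *)
Lemma is_path_concat g h : is_path g -> is_path h -> g 1 = h 0 ->
  is_path (path_concat g h).
Proof.
move=> /path_homotopic_refl pg /path_homotopic_refl ph gh.
exact: path_homotopic_is_path (path_concat_homotopic gh pg ph).
Qed.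

End Homotopy.

Section Groupoid.
Context {R : realType} {X : topologicalType}.
Implicit Types (g h : R -> X) (a b c d : Pi R X) (x : X).
Local Notation I := (@unit_itv R).

Lemma unit_itv0 : I 0. Proof. by rewrite unit_itvE lexx ler01. Qed.
Lemma unit_itv1 : I 1. Proof. by rewrite unit_itvE lexx ler01. Qed.

Lemma is_path_cst x : is_path (cst x : R -> X).
Proof. by apply/is_pathP/continuous_cont_on => t; exact: cvg_cst. Qed.

(* [pcls] and [pmul] are made total by replacing what is not a path by a constant
   path; the groupoid laws therefore carry composability hypotheses. *)
Definition fix_path g := if pselect (is_path g) then g else cst (g 0).

Lemma fix_path_is_path g : is_path (fix_path g).
Proof. by rewrite /fix_path; case: pselect => [pg|_] /=; [exact: pg|exact: is_path_cst]. Qed.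

Definition pcls g : Pi R X :=
  exist _ (path_class (fix_path g)) (ex_intro2 _ _ _ (@fix_path_is_path g) erefl).

Lemma path_class_eqP g h : is_path g -> is_path h ->
  path_class g = path_class h <-> path_homotopic g h.
Proof.
move=> pg ph; split=> [e|gh].
  have : path_class h h by exact: path_homotopic_refl.
  by rewrite -e.
apply/seteqP; split => k /= hk; last exact: path_homotopic_trans hk.
exact: path_homotopic_trans (path_homotopic_sym gh) hk.
Qed.

Lemma sval_pcls g : is_path g -> sval (pcls g) = path_class g.
Proof. by rewrite /= /fix_path; case: pselect. Qed.

Lemma Pi_inj c d : sval c = sval d -> c = d.
Proof. by move: c d => [c pc] [d pd] /= cd; subst d; congr exist; exact: Prop_irrelevance. Qed.

Lemma pcls_eqP g h : is_path g -> is_path h ->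
  pcls g = pcls h <-> path_homotopic g h.
Proof.
move=> pg ph; rewrite -path_class_eqP//; split => [e|e].
  by rewrite -!sval_pcls// e.
by apply: Pi_inj; rewrite !sval_pcls.
Qed.

Lemma pcls_eq g h : is_path g -> {in I, g =1 h} -> pcls g = pcls h.
Proof.
move=> pg /(path_homotopic_eq pg) gh; apply/pcls_eqP => //.
exact: path_homotopic_is_path gh.
Qed.

Definition prep c : R -> X := sval (cid2 (proj2_sig c)).

Lemma prep_path c : is_path (prep c).
Proof. by rewrite /prep; case: cid2. Qed.
Arguments prep_path : clear implicits.
Hint Resolve prep_path : core.

Lemma prepK c : pcls (prep c) = c.
Proof. by apply: Pi_inj; rewrite sval_pcls// /prep; case: cid2. Qed.

Definition psrc c := prep c 0.
Definition ptgt c := prep c 1.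

Lemma psrc_cls g : is_path g -> psrc (pcls g) = g 0.
Proof.
move=> pg; have := prepK (pcls g) => /pcls_eqP => /(_ (prep_path _) pg).
by move=> /path_homotopic_ends[].
Qed.

Lemma ptgt_cls g : is_path g -> ptgt (pcls g) = g 1.
Proof.
move=> pg; have := prepK (pcls g) => /pcls_eqP => /(_ (prep_path _) pg).
by move=> /path_homotopic_ends[].
Qed.

Definition pid x := pcls (cst x).

Lemma psrc_id x : psrc (pid x) = x.
Proof. by rewrite psrc_cls//; exact: is_path_cst. Qed.

Lemma ptgt_id x : ptgt (pid x) = x.
Proof. by rewrite ptgt_cls//; exact: is_path_cst. Qed.

Definition pmul a b := pcls (path_concat (prep a) (prep b)).

Lemma pmul_cls g h : is_path g -> is_path h -> g 1 = h 0 ->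
  pmul (pcls g) (pcls h) = pcls (path_concat g h).
Proof.
move=> pg ph gh.
have hg : path_homotopic (prep (pcls g)) g by apply/pcls_eqP => //; rewrite prepK.
have hh : path_homotopic (prep (pcls h)) h by apply/pcls_eqP => //; rewrite prepK.
have e : prep (pcls g) 1 = prep (pcls h) 0.
  by rewrite -[LHS]/(ptgt _) -[RHS]/(psrc _) ptgt_cls// psrc_cls.
apply/pcls_eqP; try exact: is_path_concat.
exact: path_concat_homotopic.
Qed.

Lemma psrc_mul a b : ptgt a = psrc b -> psrc (pmul a b) = psrc a.
Proof.
move=> ab; rewrite psrc_cls; last exact: is_path_concat.
by rewrite /path_concat ifT ?invr_ge0// mulr0.
Qed.

Lemma ptgt_mul a b : ptgt a = psrc b -> ptgt (pmul a b) = ptgt b.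
Proof.
move=> ab; rewrite ptgt_cls; last exact: is_path_concat.
rewrite /path_concat ifF; last by apply/negbTE; rewrite -ltNge; lra.
by rewrite mulr1; congr (prep b _); lra.
Qed.

(** The standard presentation of a class: on a convex set where [Phi] is continuous, any path with
    the same ends gives the same class ([pcls_comp]), and composition is that of pairs of points
    ([pmul_seg]). *)
Definition pseg (V : normedModType R) (Phi : V -> X) (u v : V) :=
  pcls (Phi \o line u v).

Lemma psegaa (V : normedModType R) (Phi : V -> X) (u : V) :
  pseg Phi u u = pid (Phi u).
Proof. by congr pcls; apply/funext => t /=; rewrite lineaa. Qed.

Section Seg.
Context {V : normedModType R} (D : set V) (Phi : V -> X).
Hypotheses (cD : convex D) (cPhi : cont_on D Phi).

Lemma cont_on_line (u v : V) (A : set R) : cont_on A (line u v).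
Proof.
move=> t _; apply: cont_at_line; apply: continuous_cont_at;
  [exact: cvg_cst|exact: cvg_cst|exact: cvg_id].
Qed.

Lemma pseg_path u v : D u -> D v -> is_path (Phi \o line u v).
Proof.
move=> Du Dv; apply/is_pathP/(cont_on_comp (B := D)) => //.
  by move=> t It; exact: cD.
exact: cont_on_line.
Qed.

Lemma psrc_seg u v : D u -> D v -> psrc (pseg Phi u v) = Phi u.
Proof. by move=> Du Dv; rewrite psrc_cls /= ?line0//; exact: pseg_path. Qed.

Lemma ptgt_seg u v : D u -> D v -> ptgt (pseg Phi u v) = Phi v.
Proof. by move=> Du Dv; rewrite ptgt_cls /= ?line1//; exact: pseg_path. Qed.

Lemma pcls_comp (a : R -> V) : cont_on I a -> (forall t, I t -> D (a t)) ->
  pcls (Phi \o a) = pseg Phi (a 0) (a 1).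
Proof.
move=> ca Da.
have D0 := Da _ unit_itv0; have D1 := Da _ unit_itv1.
apply/pcls_eqP; [|exact: pseg_path|].
  exact/is_pathP/(cont_on_comp (B := D)).
apply: (convex_homotopic (D := D)) => //; last 2 first.
- by rewrite line0.
- by rewrite line1.
- exact: cont_on_line.
- by move=> t It; exact: cD.
Qed.

Lemma pmul_seg u v w : D u -> D v -> D w ->
  pmul (pseg Phi u v) (pseg Phi v w) = pseg Phi u w.
Proof.
move=> Du Dv Dw.
rewrite pmul_cls; [|exact: pseg_path|exact: pseg_path|by rewrite /= line0 line1].
have -> : path_concat (Phi \o line u v) (Phi \o line v w) =
    Phi \o path_concat (line u v) (line v w).
  by apply/funext => t; rewrite /path_concat /=; case: ifP.
rewrite pcls_comp.
- congr (pseg Phi); rewrite /path_concat.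
    by rewrite ifT ?invr_ge0// mulr0 line0.
  rewrite ifF; last by apply/negbTE; rewrite -ltNge; lra.
  by rewrite (_ : _ - _ = 1) ?line1//; lra.
- apply/is_pathP/is_path_concat; try exact/is_pathP/cont_on_line.
  by rewrite line0 line1.
- move=> t; rewrite /path_concat unit_itvE => It.
  by case: ifPn => [|]; rewrite -?ltNge => t2; apply: cD => //;
    rewrite unit_itvE; lra.
Qed.

End Seg.

Lemma convex_unit_itv : convex (I : set R^o).
Proof.
move=> s t r; rewrite !unit_itvE /line => /andP[s0 s1] /andP[t0 t1] /andP[r0 r1].
rewrite /GRing.scale /=; apply/andP; split; nra.
Qed.

Lemma is_path_cont_on g : is_path g -> cont_on (I : set R^o) g.
Proof. by move=> /is_pathP. Qed.

(** A path is the image of the segment [0, 1] under itself. Typing the source as [R^o] makes it a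
    normed module, and the groupoid laws become instances of [pmul_seg]. *)
Lemma pcls_seg g : is_path g -> pcls g = pseg (g : R^o -> X) 0 1.
Proof.
move=> pg; apply: pcls_eq => // t _ /=.
by rewrite /line /GRing.scale /= mulr0 add0r mulr1.
Qed.

Lemma pmul1l c x : psrc c = x -> pmul (pid x) c = c.
Proof.
move=> <-; rewrite -{2 3}(prepK c) pcls_seg// -(psegaa (prep c : R^o -> X)).
by rewrite (pmul_seg convex_unit_itv (is_path_cont_on (prep_path c)))//;
  rewrite unit_itvE; lra.
Qed.

Lemma pmul1r c x : ptgt c = x -> pmul c (pid x) = c.
Proof.
move=> <-; rewrite -{1 3}(prepK c) pcls_seg// -(psegaa (prep c : R^o -> X)).
by rewrite (pmul_seg convex_unit_itv (is_path_cont_on (prep_path c)))//;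
  rewrite unit_itvE; lra.
Qed.

Definition pback c := pseg (prep c : R^o -> X) 1 0.

Lemma psrc_back c : psrc (pback c) = ptgt c.
Proof.
by rewrite (psrc_seg convex_unit_itv (is_path_cont_on (prep_path c)))//;
  rewrite unit_itvE; lra.
Qed.

Lemma pmulV c : pmul c (pback c) = pid (psrc c).
Proof.
rewrite -{1}(prepK c) pcls_seg// -(psegaa (prep c : R^o -> X)).
by rewrite (pmul_seg convex_unit_itv (is_path_cont_on (prep_path c)))//;
  rewrite unit_itvE; lra.
Qed.

(* All three classes are segments of the single path (gh)k. *)
Lemma pcls_mulA g h k : is_path g -> is_path h -> is_path k ->
  g 1 = h 0 -> h 1 = k 0 ->
  pmul (pmul (pcls g) (pcls h)) (pcls k) = pmul (pcls g) (pmul (pcls h) (pcls k)).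
Proof.
move=> pg ph pk gh hk.
pose G : R^o -> X := path_concat (path_concat g h) k.
have pgh := is_path_concat pg ph gh.
have e1 : path_concat g h 1 = h 1.
  rewrite /path_concat ifF; last by apply/negbTE; rewrite -ltNge; lra.
  by congr h; lra.
have pG : cont_on (I : set R^o) G.
  by apply: is_path_cont_on; apply: is_path_concat => //; rewrite e1.
(* In [G] the path [g] runs over [0, 1/4], [h] over [1/4, 1/2] and [k] over [1/2, 1]. *)
have eg : pcls g = pseg G 0 4^-1.
  apply: pcls_eq => // t /set_mem; rewrite unit_itvE => It.
  rewrite /G /path_concat /= /line /GRing.scale /= !ifT; [|lra|lra].
  by congr g; lra.
have eh : pcls h = pseg G 4^-1 2^-1.
  apply: pcls_eq => // t /set_mem; rewrite unit_itvE => It.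
  rewrite /G /path_concat /= /line /GRing.scale /= ifT; last by lra.
  case: ifPn => t2.
    have -> : t = 0 by lra.
    by rewrite -gh; congr g; lra.
  by congr h; lra.
have ek : pcls k = pseg G 2^-1 1.
  apply: pcls_eq => // t /set_mem; rewrite unit_itvE => It.
  rewrite /G /path_concat /= /line /GRing.scale /=.
  case: ifPn => t2.
    have -> : t = 0 by lra.
    rewrite ifF; last by apply/negbTE; rewrite -ltNge; lra.
    by rewrite -hk; congr h; lra.
  by congr k; lra.
rewrite eg eh ek.
by rewrite !(pmul_seg convex_unit_itv pG)// unit_itvE; lra.
Qed.

Lemma pmulA a b c : ptgt a = psrc b -> ptgt b = psrc c ->
  pmul (pmul a b) c = pmul a (pmul b c).
Proof.
by move=> ab bc; have := @pcls_mulA (prep a) (prep b) (prep c); rewrite !prepK; apply.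
Qed.

End Groupoid.
Arguments prep_path {R X} c.
#[global] Hint Resolve prep_path : core.

(** * Nice open sets and the topology of Pi(X) *)

Section Conj.
Context {R : realType} {X : topologicalType}.
Implicit Types (a b c : Pi R X).

(** Despite the name, [a] and [b] are unrelated: this changes both ends of [c] independently. *)
Definition pconj a c b := pmul (pmul a c) b.

Lemma psrc_conj a c b : ptgt a = psrc c -> ptgt c = psrc b ->
  psrc (pconj a c b) = psrc a.
Proof. by move=> ac cb; rewrite !psrc_mul// ptgt_mul. Qed.

Lemma ptgt_conj a c b : ptgt a = psrc c -> ptgt c = psrc b ->
  ptgt (pconj a c b) = ptgt b.
Proof. by move=> ac cb; rewrite !ptgt_mul// ptgt_mul. Qed.

Lemma pconj1 c : pconj (pid (psrc c)) c (pid (ptgt c)) = c.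
Proof. by rewrite /pconj pmul1l// pmul1r. Qed.

Lemma pconj_conj a' a c b b' : ptgt a' = psrc a -> ptgt a = psrc c ->
  ptgt c = psrc b -> ptgt b = psrc b' ->
  pconj a' (pconj a c b) b' = pconj (pmul a' a) c (pmul b b').
Proof.
move=> aa ac cb bb; rewrite /pconj.
rewrite -!pmulA ?ptgt_mul ?psrc_mul//; by rewrite ptgt_mul.
Qed.

End Conj.

Section Local.
Context {R : realType} {X : topologicalType}.
Implicit Types (g h : R -> X) (a b c z : Pi R X) (x y : X) (U V : set X).
Local Notation I := (@unit_itv R).
Local Notation nice := (@nice R X).

Lemma path_inP U g : path_in U g <-> is_path g /\ forall t, I t -> U (g t).
Proof.
split=> -[pg gU]; split=> //; first by move=> t It; apply: gU; exists t.
by move=> _ [t It <-]; exact: gU.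
Qed.

Lemma path_in0 U g : path_in U g -> U (g 0).
Proof. by move=> /path_inP[_]; apply; exact: unit_itv0. Qed.

Lemma path_in1 U g : path_in U g -> U (g 1).
Proof. by move=> /path_inP[_]; apply; exact: unit_itv1. Qed.

(* Apply the hypothesis to the loop along [g] and back along [h]. *)
Lemma nice_pcls U g h : pi1_trivial_in R U -> path_in U g -> path_in U h ->
  g 0 = h 0 -> g 1 = h 1 -> pcls g = pcls h.
Proof.
move=> nU /path_inP[pg gU] /path_inP[ph hU] gh0 gh1.
have cI := @convex_unit_itv R; have cph := is_path_cont_on ph.
have I0 : I 0 := unit_itv0; have I1 : I 1 := unit_itv1.
pose k : R -> X := (h : R^o -> X) \o line (1 : R^o) 0.
have pk : is_path k by apply: (pseg_path cI cph).
have gk : g 1 = k 0 by rewrite /k /= line0.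
have pgk := is_path_concat pg pk gk.
have hpg : path_homotopic (path_concat g k) (cst (g 0)).
  apply: (nU _ _ _).
  - apply/path_inP; split=> // t; rewrite /path_concat unit_itvE => It.
    case: ifPn => [|]; rewrite -?ltNge => t2.
      by apply: gU; rewrite unit_itvE; lra.
    by apply: hU; apply: cI => //; rewrite unit_itvE; lra.
  - by rewrite /path_concat ifT ?invr_ge0// mulr0.
  - rewrite /path_concat ifF; last by apply/negbTE; rewrite -ltNge; lra.
    by rewrite /k /= (_ : 2 * 1 - 1 = 1) ?line1 ?gh0//; lra.
have e : pmul (pcls g) (pcls k) = pid (g 0).
  by rewrite pmul_cls//; apply/pcls_eqP => //; exact: is_path_cst.
have eh : pmul (pcls k) (pcls h) = pid (h 1).
  by rewrite (pcls_seg ph) (pmul_seg cI cph)// psegaa.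
have k1 : k 1 = h 0 by rewrite /k /= line1.
have := congr1 (fun z => pmul z (pcls h)) e.
rewrite pmulA ?ptgt_cls ?psrc_cls// eh pmul1r ?ptgt_cls// => ->.
by rewrite pmul1l// psrc_cls.
Qed.

(** The short path of a nice [U]; by [nice_pcls] its class does not depend on the path chosen. The
    value [pid x] is a default. *)
Definition plocal U x y : Pi R X :=
  if pselect (exists g, [/\ path_in U g, g 0 = x & g 1 = y]) is left H
  then pcls (sval (cid H)) else pid x.

Lemma plocalE U g : pi1_trivial_in R U -> path_in U g ->
  pcls g = plocal U (g 0) (g 1).
Proof.
move=> nU gU; rewrite /plocal; case: pselect => [H|]; last by case; exists g.
by case: cid => h /= [hU h0 h1]; apply: (nice_pcls nU).
Qed.

Lemma plocalP U x y : nice U -> U x -> U y -> exists g,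
  [/\ path_in U g, g 0 = x, g 1 = y & plocal U x y = pcls g].
Proof.
move=> [_ pU nU] Ux Uy; have [g [gU g0 g1]] := pU x y Ux Uy.
by exists g; split => //; rewrite (plocalE nU gU) g0 g1.
Qed.

Lemma psrc_local U x y : nice U -> U x -> U y -> psrc (plocal U x y) = x.
Proof.
by move=> nU Ux Uy; have [g [[pg _] <- _ ->]] := plocalP nU Ux Uy; rewrite psrc_cls.
Qed.

Lemma ptgt_local U x y : nice U -> U x -> U y -> ptgt (plocal U x y) = y.
Proof.
by move=> nU Ux Uy; have [g [[pg _] _ <- ->]] := plocalP nU Ux Uy; rewrite ptgt_cls.
Qed.

Lemma plocalS U V x y : nice U -> nice V -> U `<=` V -> U x -> U y ->
  plocal U x y = plocal V x y.
Proof.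
move=> nU nV UV Ux Uy; have [g [gU <- <- ->]] := plocalP nU Ux Uy.
case: nV => _ _ nV; apply: plocalE => //.
by move: gU => [pg gU]; split => //; exact: subset_trans UV.
Qed.

Lemma plocal_id U x : nice U -> U x -> plocal U x x = pid x.
Proof.
move=> [_ _ nU] Ux; rewrite /pid (@plocalE U)//.
by apply/path_inP; split => //; exact: is_path_cst.
Qed.

Lemma path_in_concat U g h : path_in U g -> path_in U h -> g 1 = h 0 ->
  path_in U (path_concat g h).
Proof.
move=> /path_inP[pg gU] /path_inP[ph hU] gh; apply/path_inP.
split; first exact: is_path_concat.
move=> t; rewrite /path_concat unit_itvE => It.
by case: ifPn => [|]; rewrite -?ltNge => t2; [apply: gU|apply: hU];
  rewrite unit_itvE; lra.
Qed.

Lemma path_concat0 g h : path_concat g h 0 = g 0.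
Proof. by rewrite /path_concat ifT ?invr_ge0// mulr0. Qed.

Lemma path_concat1 g h : path_concat g h 1 = h 1.
Proof.
rewrite /path_concat ifF; last by apply/negbTE; rewrite -ltNge; lra.
by congr h; lra.
Qed.

Lemma plocal_mul U x y (z : X) : nice U -> U x -> U y -> U z ->
  pmul (plocal U x y) (plocal U y z) = plocal U x z.
Proof.
move=> nU Ux Uy Uz.
have [g [gU g0 g1 ->]] := plocalP nU Ux Uy.
have [h [hU h0 h1 ->]] := plocalP nU Uy Uz.
have gh : g 1 = h 0 by rewrite g1 h0.
case: (gU) (hU) => pg _ [ph _]; rewrite pmul_cls//.
have [_ _ nU'] := nU.
by rewrite (plocalE nU' (path_in_concat gU hU gh)) path_concat0 path_concat1 g0 h1.
Qed.

(* The sheet through [c] of the covering Pi(X) -> X * X over [U * V]. *)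
Definition psheet U V c : set (Pi R X) := [set z |
  [/\ U (psrc z), V (ptgt z) &
      z = pconj (plocal U (psrc z) (psrc c)) c (plocal V (ptgt c) (ptgt z))]].

Lemma psheet_refl U V c : nice U -> nice V -> U (psrc c) -> V (ptgt c) ->
  psheet U V c c.
Proof.
by move=> nU nV Uc Vc; split => //; rewrite !plocal_id// pconj1.
Qed.

(** With [psheet_refl] and [psheet_sym]: the sheets over a given [U * V] are the classes of an
    equivalence relation. *)
Lemma psheet_trans U V c d : nice U -> nice V -> U (psrc c) -> V (ptgt c) ->
  psheet U V c d -> psheet U V d `<=` psheet U V c.
Proof.
move=> nU nV Uc Vc [Ud Vd de] z [Uz Vz ze]; split => //.
rewrite {1}ze [X in pconj _ X _]de pconj_conj ?psrc_local ?ptgt_local//.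
by rewrite !plocal_mul.
Qed.

Lemma psheet_sym U V c d : nice U -> nice V -> U (psrc c) -> V (ptgt c) ->
  psheet U V c d -> psheet U V d c.
Proof.
move=> nU nV Uc Vc [Ud Vd de]; split => //.
rewrite [X in pconj _ X _]de pconj_conj ?psrc_local ?ptgt_local//.
by rewrite !plocal_mul// !plocal_id// pconj1.
Qed.

Lemma psheet_inj U V c (y z : Pi R X) : psheet U V c y -> psheet U V c z ->
  psrc y = psrc z -> ptgt y = ptgt z -> y = z.
Proof. by move=> [_ _ ye] [_ _ ze] s t; rewrite ye ze s t. Qed.

Lemma psheetS U V U' V' c : nice U -> nice V -> nice U' -> nice V' ->
  U' `<=` U -> V' `<=` V -> U' (psrc c) -> V' (ptgt c) ->
  psheet U' V' c `<=` psheet U V c.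
Proof.
move=> nU nV nU' nV' UU VV Uc Vc z [Uz Vz ze].
split; [exact: UU|exact: VV|].
by rewrite {1}ze (plocalS nU' nU)// (plocalS nV' nV).
Qed.

(** In nice sets the classes of [d1] and [d2] depend only on their ends, so a basic set has one
    point for each pair of ends. *)
Lemma Pi_basicE U V g : nice U -> nice V -> is_path g -> U (g 0) -> V (g 1) ->
  Pi_basic U V g = psheet U V (pcls g).
Proof.
move=> nU nV pg Ug Vg; have [_ _ tU] := nU; have [_ _ tV] := nV.
apply/seteqP; split => z /=.
- move=> [d [e [[dU d1] [eV e0] ze]]].
  have [[pd _] [pe _]] := (dU, eV).
  have pdg := is_path_concat pd pg d1.
  have pdge : is_path (path_concat (path_concat d g) e).
    by apply: is_path_concat => //; rewrite path_concat1.
  have {ze}-> : z = pconj (pcls d) (pcls g) (pcls e).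
    rewrite /pconj !pmul_cls ?path_concat1//.
    by apply: Pi_inj; rewrite sval_pcls.
  rewrite /psheet /= psrc_conj ?ptgt_conj ?psrc_cls ?ptgt_cls//.
  rewrite (plocalE tU dU) (plocalE tV eV) d1 e0.
  by split => //; [exact: path_in0 dU|exact: path_in1 eV].
- rewrite /psheet /= psrc_cls// ptgt_cls// => -[Uz Vz ze].
  have [d [dU d0 d1 de]] := plocalP nU Uz Ug.
  have [e [eV e0 e1 ee]] := plocalP nV Vg Vz.
  have [[pd _] [pe _]] := (dU, eV).
  have pdg := is_path_concat pd pg d1.
  exists d, e; split => //.
  rewrite {1}ze de ee /pconj !pmul_cls ?path_concat1 ?sval_pcls//.
  by apply: is_path_concat => //; rewrite path_concat1.
Qed.

Lemma psheet_open U V c : nice U -> nice V -> U (psrc c) -> V (ptgt c) ->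
  open (psheet U V c).
Proof.
move=> nU nV Uc Vc.
have bs : @Pi_basis R X (psheet U V c).
  exists U, V, (prep c); split => //.
  by rewrite Pi_basicE// prepK.
exists [set psheet U V c]; last by rewrite bigcup_set1.
move=> _ ->; exists (fset1 (psheet U V c)).
  by move=> A /fset1P ->; exact: mem_set.
by rewrite set_fset1 bigcap_set1.
Qed.

Definition nice_basis := forall x (O : set X), nbhs x O ->
  exists U, [/\ nice U, U x & U `<=` O].

Lemma nbhs_sheet U V c : nice U -> nice V -> U (psrc c) -> V (ptgt c) ->
  nbhs c (psheet U V c).
Proof.
move=> nU nV Uc Vc; apply: open_nbhs_nbhs; split; first exact: psheet_open.
exact: psheet_refl.
Qed.

(** Here the nice basis of X turns the subbasis into a basis. By induction on the number of basic
    sets, a finite intersection containing [c] contains the sheet through [c] over smaller nice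
    sets. *)
Lemma nbhs_PiP c (A : set (Pi R X)) : nice_basis -> nbhs c A ->
  exists U V, [/\ nice U, nice V, U (psrc c), V (ptgt c) & psheet U V c `<=` A].
Proof.
move=> nb [B [[D sD <-] [F DF Fc] BA]].
have [E sE EF] := sD _ DF.
suff [U [V [nU nV Uc Vc h]]] : exists U V,
    [/\ nice U, nice V, U (psrc c), V (ptgt c) & psheet U V c `<=` F].
  by exists U, V; split => // z /h Fz; apply: BA; exists F.
rewrite -EF in Fc *.
elim/finSet_rect: E sE Fc {EF} => E IH sE Fc.
have [->|[S ES]] := fset_0Vmem E.
  have [U [nU Uc _]] := nb (psrc c) setT (filterT).
  have [V [nV Vc _]] := nb (ptgt c) setT (filterT).
  by exists U, V; split => // z _ S; rewrite /= inE.
have [|||U [V [nU nV Uc Vc h]]] := IH (E `\ S)%fset.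
- exact: fproperD1.
- by move=> S' /fsetD1P[_ /sE].
- by move=> S' /= /fsetD1P[_ S'E]; exact: Fc.
have /set_mem[U' [V' [g [[nU' nV'] pg Ug Vg SE]]]] := sE S ES.
have := Fc S ES; rewrite SE Pi_basicE// => Sc.
have [Uc' Vc' _] := Sc.
have [U2 [nU2 Uc2 U2s]] := nb (psrc c) (U `&` U') (open_nbhs_nbhs (conj
  (openI (let: And3 o _ _ := nU in o) (let: And3 o _ _ := nU' in o)) (conj Uc Uc'))).
have [V2 [nV2 Vc2 V2s]] := nb (ptgt c) (V `&` V') (open_nbhs_nbhs (conj
  (openI (let: And3 o _ _ := nV in o) (let: And3 o _ _ := nV' in o)) (conj Vc Vc'))).
exists U2, V2; split => // z zs S' S'E.
have [S'S|S'S] := eqVneq S' S; last first.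
  apply: h; last by apply/fsetD1P.
  by apply: (psheetS nU nV nU2 nV2) zs => // w; [move=> /U2s[]|move=> /V2s[]].
rewrite S'S SE Pi_basicE//=; apply: psheet_trans Sc _ _ => //.
- by rewrite psrc_cls.
- by rewrite ptgt_cls.
- by apply: (psheetS nU' nV' nU2 nV2) zs => // w; [move=> /U2s[]|move=> /V2s[]].
Qed.
End Local.

Section PiTopology.
Context {R : realType} {X : topologicalType}.
Hypothesis nbX : @nice_basis R X.
Implicit Types (c z : Pi R X) (x y : X) (U V : set X).

Lemma psrc_continuous : continuous (@psrc R X).
Proof.
move=> c O cO; have [U [nU Uc UO]] := nbX cO.
have [V [nV Vc _]] := nbX (x := ptgt c) (O := setT) filterT.
apply: filterS (nbhs_sheet nU nV Uc Vc) => z [Uz _ _]; exact: UO.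
Qed.

Lemma ptgt_continuous : continuous (@ptgt R X).
Proof.
move=> c O cO; have [V [nV Vc VO]] := nbX cO.
have [U [nU Uc _]] := nbX (x := psrc c) (O := setT) filterT.
apply: filterS (nbhs_sheet nU nV Uc Vc) => z [_ Vz _]; exact: VO.
Qed.

(** Different ends are separated in X. Classes with the same ends lie on sheets over the same
    [U * V], and two such sheets are equal or disjoint. *)
Lemma Pi_hausdorff : hausdorff_space X -> hausdorff_space (Pi R X).
Proof.
move=> hX c d cd.
have sE : psrc c = psrc d.
  apply: hX => A B /psrc_continuous cA /psrc_continuous dB.
  by have [z [Az Bz]] := cd _ _ cA dB; exists (psrc z).
have tE : ptgt c = ptgt d.
  apply: hX => A B /ptgt_continuous cA /ptgt_continuous dB.
  by have [z [Az Bz]] := cd _ _ cA dB; exists (ptgt z).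
have [U [nU Uc _]] := nbX (x := psrc c) (O := setT) filterT.
have [V [nV Vc _]] := nbX (x := ptgt c) (O := setT) filterT.
have [Ud Vd] : U (psrc d) /\ V (ptgt d) by rewrite -sE -tE.
have [z [cz dz]] := cd _ _ (nbhs_sheet nU nV Uc Vc) (nbhs_sheet nU nV Ud Vd).
have [Uz Vz _] := cz.
apply: (@psheet_inj _ _ U V z) => //; exact: psheet_sym.
Qed.

End PiTopology.

Section SegLocal.
Context {R : realType} {X : topologicalType} {V : normedModType R}.
Context (D : set V) (Phi : V -> X).
Hypotheses (cD : convex D) (cPhi : cont_on D Phi).

Lemma near_line (u0 : V) (U : set X) : D u0 -> open U -> U (Phi u0) ->
  \forall u \near u0, D u ->
    path_in U (Phi \o line u u0 : R -> X) /\ path_in U (Phi \o line u0 u : R -> X).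
Proof.
move=> Du0 oU Uu0.
have /(cPhi Du0)/nbhs_ballP[r /= r0 rU] := open_nbhs_nbhs (conj oU Uu0).
apply/nbhs_ballP; exists r => //= u ru Du.
have cr := @convex_ball _ _ u0 r.
have ru0 : ball u0 r u0 by exact: ballxx.
split; apply/path_inP.
- split; first exact: (pseg_path cD cPhi).
  by move=> t It; apply: (rU _ (cr _ _ _ ru ru0 It)); exact: cD.
- split; first exact: (pseg_path cD cPhi).
  by move=> t It; apply: (rU _ (cr _ _ _ ru0 ru It)); exact: cD.
Qed.

(** Segments close to [u0] are mapped into [U], so they give the short paths of [U]. This links the
    segments of cells with the sheets. *)
Lemma near_seg (u0 : V) (U : set X) : D u0 -> nice R U -> U (Phi u0) ->
  \forall u \near u0, D u -> [/\ U (Phi u),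
    pseg Phi u u0 = plocal U (Phi u) (Phi u0) &
    pseg Phi u0 u = plocal U (Phi u0) (Phi u)].
Proof.
move=> Du0 nU Uu0; have [oU _ tU] := nU.
apply: filterS (near_line Du0 oU Uu0) => u h Du; have [h1 h2] := h Du.
split.
- by have := path_in0 h1; rewrite /= line0.
- by rewrite /pseg (plocalE tU h1) /= line0 line1.
- by rewrite /pseg (plocalE tU h2) /= line0 line1.
Qed.

End SegLocal.

Lemma compact_bigcup_finite (T : topologicalType) (S : Type) (K : set T)
    (A : T -> set S) : compact K ->
  (forall x, K x -> exists F : set S, finite_set F /\
     \forall y \near x, K y -> A y `<=` F) ->
  finite_set (\bigcup_(x in K) A x).
Proof.
move=> /compact_near_coveringP/near_covering_withinP cK locA.
(* The filter of properties that hold for all sets containing some finite set. Along it, the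
   near-covering form of compactness yields one finite set for all of [K]. *)
pose G : set_system (set S) := [set Q | exists2 F0 : set S, finite_set F0 &
  forall F, F0 `<=` F -> Q F].
have FG : Filter G.
  split.
  - by exists set0.
  - move=> P Q [F1 f1 P1] [F2 f2 P2]; exists (F1 `|` F2).
      by rewrite finite_setU.
    move=> F F12; split.
      by apply: P1; apply: subset_trans F12; exact: subsetUl.
    by apply: P2; apply: subset_trans F12; exact: subsetUr.
  - by move=> P Q PQ [F f h]; exists F => // F' /h /PQ.
have [|F0 f0 /(_ _ (@subset_refl _ F0)) h] :=
    cK _ G (fun F x => A x `<=` F) FG.
  move=> x Kx; have [F [fF xF]] := locA x Kx.
  exists ([set y | K y -> A y `<=` F], [set F' | F `<=` F']) => /=.
    by split => //; exists F.
  by move=> [y F'] /= [yF FF'] Ky; apply: subset_trans FF'; exact: yF.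
by apply: sub_finite_set f0 => s [x Kx]; exact: h.
Qed.

(** * Euclidean disks and spheres *)

Section Disks.
Context {R : realType}.

Definition sqn n (v : 'rV[R]_n) := \sum_(i < n) v ord0 i ^+ 2.

Lemma sqn_ge0 n (v : 'rV[R]_n) : 0 <= sqn v.
Proof. by apply: sumr_ge0 => i _; exact: sqr_ge0. Qed.

Lemma sqn0 n : sqn (0 : 'rV[R]_n) = 0.
Proof. by rewrite /sqn big1// => i _; rewrite mxE expr0n. Qed.

Lemma sqn_eq0 n (v : 'rV[R]_n) : sqn v = 0 -> v = 0.
Proof.
move=> /eqP; rewrite /sqn psumr_eq0; last by move=> i _; exact: sqr_ge0.
move=> /allP h; apply/rowP => i; rewrite mxE.
by have := h i (mem_index_enum i); rewrite sqrf_eq0 => /eqP.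
Qed.

Lemma sqnZ n a (v : 'rV[R]_n) : sqn (a *: v) = a ^+ 2 * sqn v.
Proof. by rewrite /sqn mulr_sumr; apply: eq_bigr => i _; rewrite mxE exprMn. Qed.

Lemma sqn_continuous n : continuous (@sqn n).
Proof.
rewrite /sqn; elim: (index_enum _) => [|i s IH].
  have -> : (fun w : 'rV[R]_n => \sum_(i <- [::]) w ord0 i ^+ 2) = cst 0.
    by apply/funext => w; rewrite big_nil.
  exact: cst_continuous.
have -> : (fun w : 'rV[R]_n => \sum_(j <- i :: s) w ord0 j ^+ 2) =
    (fun w => w ord0 i ^+ 2 + \sum_(j <- s) w ord0 j ^+ 2).
  by apply/funext => w; rewrite big_cons.
move=> v; apply: (@cvgD _ R^o _ (nbhs v)); last exact: IH.
by apply: (@cvgM _ _ (nbhs v)); exact: coord_continuous.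
Qed.

Lemma disk_convex n : convex (closed_disk R n).
Proof.
move=> a b t; rewrite /closed_disk /= unit_itvE => a1 b1 /andP[t0 t1].
have t1' : 0 <= 1 - t by rewrite subr_ge0.
apply: (@le_trans _ _ ((1 - t) * sqn a + t * sqn b)); last first.
  apply: (@le_trans _ _ ((1 - t) * 1 + t * 1)); last by lra.
  by apply: lerD; exact: ler_wpM2l.
rewrite /sqn !mulr_sumr -big_split /=; apply: ler_sum => i _.
rewrite /line !mxE; set x := a _ _; set y := b _ _.
(* The difference of the two sides is [t * (1 - t) * (x - y) ^+ 2]. *)
have := mulr_ge0 (mulr_ge0 t0 t1') (sqr_ge0 (x - y)); nra.
Qed.

Lemma open_disk_closed_disk n : open_disk R n `<=` closed_disk R n.
Proof. by move=> v /ltW. Qed.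

Lemma sphere_closed_disk n : sphere R n `<=` closed_disk R n.
Proof. by move=> v; rewrite /sphere /closed_disk /= => ->. Qed.

Lemma open_disk0 n : open_disk R n 0.
Proof. by rewrite /open_disk /= -/(sqn _) sqn0. Qed.

Lemma closed_disk0 n : closed_disk R n 0.
Proof. exact/open_disk_closed_disk/open_disk0. Qed.

Lemma closed_disk_compact n : compact (closed_disk R n).
Proof.
apply: bounded_closed_compact.
  exists 1; split => // M M1 v; rewrite /closed_disk /= => v1.
  apply: le_trans (ltW M1); rewrite [leLHS]mx_normrE.
  apply: bigmax_le => // -[i j] _ /=.
  rewrite [i]ord1 -(@expr_le1 _ 2)// -normrX (ger0_norm (sqr_ge0 _)).
  apply: le_trans v1; rewrite (bigD1 j)//= lerDl.
  by apply: sumr_ge0 => k _; exact: sqr_ge0.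
have -> : closed_disk R n = @sqn n @^-1` [set x | x <= 1] by [].
by apply: preimage_closed; [move=> v _; exact: sqn_continuous|exact: closed_le].
Qed.

Lemma sphere_compact n : compact (sphere R n).
Proof.
apply: (subclosed_compact _ (@closed_disk_compact n)); last exact: sphere_closed_disk.
have -> : sphere R n = @sqn n @^-1` [set x | x = 1] by [].
by apply: preimage_closed; [move=> v _; exact: sqn_continuous|exact: closed_eq].
Qed.

End Disks.

(** * Filtration of a countable complex by compact parts *)

Lemma finite_set_bounded (T : Type) (A : set T) (f : T -> nat) :
  finite_set A -> exists n, forall a, A a -> (f a < n)%N.
Proof.
move=> /(finite_image f) /finite_fsetP[B fB].
exists (\max_(i <- B) i).+1 => a Aa; rewrite ltnS.
have : [set f a | a in A] (f a) by exists a.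
by rewrite fB /= => faB; exact: (@leq_bigmax_seq _ _ predT id).
Qed.

Section CWOrder.
Context {R : realType} {X : topologicalType} (C : cw_complex R X).
Implicit Types (e : cw_cell C).

Definition open_cell e := cw_char e @` open_disk R (cw_dim e).

Lemma open_cell_inj e e' x : open_cell e x -> open_cell e' x -> e = e'.
Proof. by move=> ex e'x; have [f [_ fu]] := cw_partition C x; rewrite -(fu e)// (fu e'). Qed.

Lemma open_cellP x : exists e, open_cell e x.
Proof. by have [f [fx _]] := cw_partition C x; exists f. Qed.

(* Cells are ranked so that the boundary of each is carried by cells of smaller
   rank. Since the rank of a cell is at least its index in an enumeration of
   the cells, it can be refined into an injective one. *)
Lemma countable_cw_order : cw_countable C -> exists ord : cw_cell C -> nat,
  injective ord /\ forall e v, sphere R (cw_dim e) v ->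
    exists2 e', (ord e' < ord e)%N & open_cell e' (cw_char e v).
Proof.
move=> /pcard_leP[idx].
have idx_inj : injective idx by move=> e e'; apply: 'inj_idx; exact: in_setT.
have /choice[F HF] := @cw_closure_finite _ _ C.
(* The weight of [e] is [idx e] plus a strict bound of the weights of the cells in [F e]. The
   [pselect] provides the proof that the recursive call decreases the dimension. *)
pose step e (rec : forall e', (cw_dim e' < cw_dim e)%coq_nat -> nat) : nat :=
  (idx e + sval (cid (finite_set_bounded (fun e' : cw_cell C =>
     if pselect (cw_dim e' < cw_dim e)%coq_nat is left h then rec e' h else 0%N)
     (let: And3 f _ _ := HF e in f))))%N.
have wf : well_founded (fun e e' => (cw_dim e < cw_dim e')%coq_nat).
  exact: (Wf_nat.well_founded_ltof _ (@cw_dim R X C)).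
pose w := Fix wf (fun _ => nat) step.
have wE e : w e = step e (fun e' _ => w e').
  rewrite /w Fix_eq// => {}e f g fg; congr step.
  by apply: functional_extensionality_dep => e'; apply: functional_extensionality_dep.
have idxw e : (idx e <= w e)%N by rewrite wE leq_addr.
have wF e e' : F e e' -> (w e' < w e)%N.
  move=> Fe; rewrite (wE e) /step; case: cid => n /= hn.
  have [_ dF _] := HF e; have := hn _ Fe; case: pselect => [_|]; last first.
    by have /ssrnat.ltP := dF _ Fe.
  by move=> /leq_trans; apply; exact: leq_addl.
(* A lexicographic code of the pair [w e], [idx e]: since [idx e <= w e], the blocks belonging to
   different weights do not overlap. *)
pose ord e := (w e * (w e).+1 + idx e)%N.
have ordw e e' : (w e' < w e)%N -> (ord e' < ord e)%N.
  rewrite /ord => ww; have := idxw e'; nia.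
exists ord; split.
  move=> e e' ee'; apply: idx_inj.
  have [/ordw|/ordw|we] := ltngtP (w e) (w e'); rewrite ?ee' ?ltnn//.
  by move: ee'; rewrite /ord we => /addnI.
move=> e v sv; have [_ _ bF] := HF e.
have [|e' Fe' e'v] := bF (cw_char e v); first by exists v.
by exists e' => //; apply/ordw/wF.
Qed.

End CWOrder.

Section CWFiltration.
Context {R : realType} {X : topologicalType} (C : cw_complex R X).
Variable ord : cw_cell C -> nat.
Hypothesis ord_inj : injective ord.
Hypothesis ord_bd : forall e v, sphere R (cw_dim e) v ->
  exists2 e', (ord e' < ord e)%N & open_cell e' (cw_char e v).
Implicit Types (e : cw_cell C) (n : nat).

Let hX : hausdorff_space X := cw_hausdorff C.

Lemma cw_char_cont_on e : cont_on (closed_disk R (cw_dim e)) (cw_char e).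
Proof. by apply/cont_onP; exact: cw_char_continuous. Qed.

Lemma closed_disk_cases n (v : 'rV[R]_n) :
  closed_disk R n v -> open_disk R n v \/ sphere R n v.
Proof.
by rewrite /closed_disk /open_disk /sphere /= le_eqVlt => /orP[/eqP|]; [right|left].
Qed.

Lemma open_cell_sub e : open_cell e `<=` closed_cell e.
Proof. by move=> _ [v vD <-]; exists v => //; exact: open_disk_closed_disk. Qed.

Lemma closed_cell_compact e : compact (closed_cell e).
Proof. apply: cont_on_compact; [exact: cw_char_cont_on|exact: closed_disk_compact]. Qed.

Lemma closed_cell_closed e : closed (closed_cell e).
Proof. by apply: compact_closed => //; exact: closed_cell_compact. Qed.

(** At most one cell is added from [n] to [n.+1], because [ord] is injective. A rank need not be
    taken, whence [cw_part_skip]. *)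
Definition cw_part n : set X := \bigcup_(e in [set e | (ord e < n)%N]) open_cell e.

Lemma cw_partS m n : (m <= n)%N -> cw_part m `<=` cw_part n.
Proof. by move=> mn x [e /= em ex]; exists e => //=; exact: leq_trans mn. Qed.

Lemma cw_part_cover x : exists n, cw_part n x.
Proof.
by have [e ex] := open_cellP C x; exists (ord e).+1; exists e => /=.
Qed.

Lemma sphere_cw_part e v : sphere R (cw_dim e) v -> cw_part (ord e) (cw_char e v).
Proof. by move=> /ord_bd[e' e'e e'v]; exists e'. Qed.

Lemma closed_cell_cw_part e n : (ord e < n)%N -> closed_cell e `<=` cw_part n.
Proof.
move=> en _ [v /closed_disk_cases[vD|vD] <-]; first by exists e => //; exists v.
by apply: (cw_partS (ltnW en)); exact: sphere_cw_part.
Qed.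

Lemma cw_part0 : cw_part 0 = set0.
Proof. by apply/seteqP; split => x // -[]. Qed.

Lemma cw_part_ord e : cw_part (ord e).+1 = cw_part (ord e) `|` closed_cell e.
Proof.
apply/seteqP; split => x.
  move=> [e' /=]; rewrite ltnS leq_eqVlt => /orP[/eqP/ord_inj ->|e'e] e'x.
    by right; exact: open_cell_sub.
  by left; exists e'.
by move=> [|]; [exact: cw_partS|exact: closed_cell_cw_part].
Qed.

Lemma cw_part_skip n : ~ (exists e, ord e = n) -> cw_part n.+1 = cw_part n.
Proof.
move=> nex; apply/seteqP; split; last exact: cw_partS.
move=> x [e' /=]; rewrite ltnS leq_eqVlt => /orP[/eqP e'n|e'n] e'x.
  by exfalso; apply: nex; exists e'.
by exists e'.
Qed.

Lemma cw_part_compact n : compact (cw_part n).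
Proof.
elim: n => [|n IH]; first by rewrite cw_part0; exact: compact0.
have [[e en]|nex] := pselect (exists e, ord e = n).
  rewrite -en in IH *.
  by rewrite cw_part_ord; apply: compactU; [exact: IH|exact: closed_cell_compact].
by rewrite cw_part_skip.
Qed.

Lemma cw_part_closed n : closed (cw_part n).
Proof. by apply: compact_closed => //; exact: cw_part_compact. Qed.

Lemma open_cell_notin_part e x : open_cell e x -> ~ cw_part (ord e) x.
Proof. by move=> ex [e' /= + e'x]; rewrite (open_cell_inj ex e'x) ltnn. Qed.

Lemma cw_part_coherent (A : set X) : (forall n, closed (A `&` cw_part n)) -> closed A.
Proof.
move=> cA; apply: (cw_weak_topology (c := C)) => e.
rewrite -/(closed_cell e) -(setIidr (@closed_cell_cw_part e _ (ltnSn _))) setIA.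
by apply: closedI => //; exact: closed_cell_closed.
Qed.

Definition part_open n (S : set X) :=
  forall y, S y -> \forall z \near y, cw_part n z -> S z.

Lemma part_open_closed n (S : set X) : S `<=` cw_part n -> part_open n S ->
  closed (cw_part n `\` S).
Proof.
move=> Sn oS; rewrite -openC openE => y nSy; rewrite /interior.
have [yn|yn] := pselect (cw_part n y); last first.
  apply: filterS (open_nbhs_nbhs (conj (closed_openC (@cw_part_closed n)) yn)).
  by move=> z zn [].
have Sy : S y by apply: contrapT => nSy'; exact: nSy.
by apply: filterS (oS y Sy) => z h [/h].
Qed.

Lemma part_open_open (U : set X) :
  (forall n, part_open n (U `&` cw_part n)) -> open U.
Proof.
move=> oU; rewrite -[U]setCK; apply: closed_openC; apply: cw_part_coherent => n.
rewrite (_ : _ `&` _ = cw_part n `\` (U `&` cw_part n)); last first.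
  by apply/seteqP; split => x; [move=> [nU xn]; split => // -[]|
    move=> [xn nU]; split => // Ux; exact: nU].
by apply: part_open_closed => // x [].
Qed.

(* Otherwise a sequence of points of K outside the successive parts would have
   closed tails with empty intersection. *)
Lemma compact_cw_part (K : set X) : compact K -> exists n, K `<=` cw_part n.
Proof.
move=> cK; apply: contrapT => nK.
have /choice[x hx] n : exists y, K y /\ ~ cw_part n y.
  apply: contrapT => h; apply: nK; exists n => y Ky; apply: contrapT => ny.
  by apply: h; exists y.
pose O n := ~` [set x k | k in [set k | (n <= k)%N]].
have oO n : open (O n).
  (* The part of index [m] can only contain terms of index below [m], so a tail of the sequence
     meets it in a finite set. *)
  apply: closed_openC; apply: cw_part_coherent => m.
  apply: compact_closed => //; apply: finite_compact.
  apply: (@sub_finite_set _ _ [set x k | k in `I_m]); last exact: finite_image.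
  move=> _ [[k /= nk <-] km]; exists k => //=.
  by rewrite ltnNge; apply/negP => mk; apply: (hx k).2; exact: cw_partS km.
have [|N _ hN] := (compact_near_coveringP K).1 cK nat \oo (fun n y => O n y) _.
  move=> y Ky; have [m ym] := cw_part_cover y.
  have Omy : O m y.
    by move=> [k /= mk xky]; apply: (hx k).2; rewrite xky; exact: cw_partS ym.
  exists (O m, [set k | (m <= k)%N]).
    by split => /=; [exact: open_nbhs_nbhs|exists m].
  by move=> [z k] /= [Oz mk] [j /= kj xj]; apply: Oz; exists j => //=; exact: leq_trans kj.
have := hN N (leqnn N) (x N) (hx N).1; apply.
by exists N => /=.
Qed.

End CWFiltration.

(** * Local contractibility *)

Section Deformation.
Context {R : realType} {X : topologicalType}.
Local Notation I := (@unit_itv R).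
Implicit Types (S T : set X).

(** The homotopies take place in X and may leave [S]. Compared with [pi1_trivial_in], the form with
    two paths passes through a deformation without building loops. *)
Definition simply_in S := forall g h : R -> X, path_in S g -> path_in S h ->
  g 0 = h 0 -> g 1 = h 1 -> pcls g = pcls h.

Lemma path_in_rev S (g : R -> X) : path_in S g ->
  path_in S (g \o (fun t => (-1) * t + 1)).
Proof.
move=> /path_inP[/is_pathP cg gS]; have h t : I t -> I (-1 * t + 1).
  by rewrite !unit_itvE; lra.
apply/path_inP; split; last by move=> t /h; exact: gS.
apply/is_pathP; apply: (cont_on_comp (B := I)) => //.
by apply: cont_on_affine; apply: continuous_cont_on => t; exact: cvg_id.
Qed.

Lemma path_in_homotopy S (r : X * R -> X) y : cont_on (S `*` I) r -> S y ->
  (forall s, I s -> S (r (y, s))) -> path_in S (fun s => r (y, s)).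
Proof.
move=> cr Sy rS; apply/path_inP; split => //; apply/is_pathP.
apply: (@cont_on_comp _ _ _ _ (S `*` I) (fun s : R => (y, s)) r) => //.
by move=> t _; apply: cont_at_pair; apply: continuous_cont_at;
  [exact: cvg_cst|exact: cvg_id].
Qed.

(* The traces of the deformation at the two ends of a path, together with the
   path and its image under the retraction, bound a square. *)
Lemma deformation_simply_in S T (r : X * R -> X) : cont_on (T `*` I) r ->
  (forall y, T y -> r (y, 0) = y) -> (forall y, T y -> S (r (y, 1))) ->
  simply_in S -> simply_in T.
Proof.
move=> cr r0 r1 sS.
pose I2 : set (R^o * R^o) := I `*` I.
have cI := @convex_unit_itv R.
have cI2 : convex I2.
  by move=> [a b] [c d] t [/= Ia Ib] [/= Ic Id] It; split => /=; exact: cI.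
have I0 : I 0 := unit_itv0; have I1 : I 1 := unit_itv1.
pose rho y := pcls (fun s : R => r (y, s)).
have sq g : path_in T g -> psrc (rho (g 1)) = g 1 /\
    pmul (pcls g) (rho (g 1)) = pmul (rho (g 0)) (pcls (fun t => r (g t, 1))).
  move=> /path_inP[/is_pathP cg gT].
  pose Phi (p : R^o * R^o) : X := r (g p.1, p.2).
  have cPhi : cont_on I2 Phi.
    apply: (@cont_on_comp _ _ _ _ (T `*` I) (fun p : R^o * R^o => (g p.1, p.2)) r) => //.
      by move=> [a b] [/= Ia Ib]; split => //=; exact: gT.
    move=> p [Ip1 Ip2]; apply: cont_at_pair; last exact: cont_at_snd.
    by apply: (cont_at_comp (B := I)); [by move=> y []|exact: cont_at_fst|exact: cg].
  have e1 : pcls g = pseg Phi (0, 0) (1, 0).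
    apply: pcls_eq; first exact/is_pathP.
    move=> t /set_mem It; rewrite /Phi /line /= /GRing.scale /=.
    by rewrite !mulr0 addr0 add0r mulr1 r0//; exact: gT.
  have e2 : rho (g 1) = pseg Phi (1, 0) (1, 1).
    congr pcls; apply/funext => t; rewrite /Phi /line /= /GRing.scale /=.
    by rewrite !mulr0 add0r !mulr1 subrK.
  have e3 : rho (g 0) = pseg Phi (0, 0) (0, 1).
    congr pcls; apply/funext => t; rewrite /Phi /line /= /GRing.scale /=.
    by rewrite !mulr0 !add0r !mulr1.
  have e4 : pcls (fun t => r (g t, 1)) = pseg Phi (0, 1) (1, 1).
    congr pcls; apply/funext => t; rewrite /Phi /line /= /GRing.scale /=.
    by rewrite !mulr0 add0r !mulr1 subrK.
  rewrite e2; split.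
    by rewrite (psrc_seg cI2 cPhi)// /Phi /= r0//; exact: gT.
  rewrite e1 e3 e4; have I00 : I2 (0, 0) by [].
  have [I10 I01] : I2 (1, 0) /\ I2 (0, 1) by [].
  have I11 : I2 (1, 1) by [].
  apply: (etrans (y := pseg Phi (0, 0) (1, 1))).
    exact: (pmul_seg cI2 cPhi I00 I10 I11).
  exact: (esym (pmul_seg cI2 cPhi I00 I01 I11)).
move=> g h gT hT gh0 gh1.
have [s1 sg] := sq g gT; have [_ sh] := sq h hT.
have rg : pcls (fun t => r (g t, 1)) = pcls (fun t => r (h t, 1)).
  have pr (k : R -> X) : path_in T k -> path_in S (fun t => r (k t, 1)).
    move=> /path_inP[/is_pathP ck kT]; apply/path_inP; split; last first.
      by move=> t It; apply/r1/kT.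
    apply/is_pathP.
    apply: (@cont_on_comp _ _ _ _ (T `*` I) (fun t : R => (k t, 1 : R)) r) => //.
      by move=> t It; split => //=; exact: kT.
    move=> t It; apply: cont_at_pair; first exact: ck.
    by apply: continuous_cont_at; exact: cvg_cst.
  by apply: sS; [exact: pr|exact: pr|rewrite gh0|rewrite gh1].
move: sh; rewrite -gh0 -gh1 -rg -sg => e.
have [pg _] := gT; have [ph _] := hT.
(* Both classes followed by the trace at [g 1] agree; cancel that trace. *)
have := congr1 (fun z => pmul z (pback (rho (g 1)))) e.
have tg : ptgt (pcls g) = psrc (rho (g 1)) by rewrite ptgt_cls.
have th : ptgt (pcls h) = psrc (rho (g 1)) by rewrite ptgt_cls// s1.
by rewrite !pmulA ?psrc_back// pmulV !pmul1r.
Qed.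

(** Follow the trace of [y] into [S], a path of [S], and the trace of [z] backwards. *)
Lemma deformation_path_connected S T (r : X * R -> X) : cont_on (T `*` I) r ->
  (forall y, T y -> r (y, 0) = y) -> (forall y, T y -> S (r (y, 1))) ->
  (forall y s, T y -> I s -> T (r (y, s))) -> S `<=` T ->
  path_connected R S -> path_connected R T.
Proof.
move=> cr r0 r1 rT ST pS y z Ty Tz.
have [k [kS k0 k1]] := pS _ _ (r1 _ Ty) (r1 _ Tz).
have kT : path_in T k by case: kS => pk kS; split => //; exact: subset_trans ST.
have py := path_in_homotopy cr Ty (fun s => rT y s Ty).
have pz := path_in_rev (path_in_homotopy cr Tz (fun s => rT z s Tz)).
have pyk := path_in_concat py kT (esym k0).
have e : path_concat (fun s => r (y, s)) k 1 =
    ((fun s => r (z, s)) \o (fun t => -1 * t + 1)) 0.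
  by rewrite path_concat1 k1 /= mulr0 add0r.
exists (path_concat (path_concat (fun s => r (y, s)) k)
  ((fun s => r (z, s)) \o (fun t => (-1) * t + 1))); split.
- exact: path_in_concat.
- by rewrite !path_concat0 r0.
- by rewrite path_concat1 /= mulr1 addNr r0.
Qed.

Lemma simply_in1 x : simply_in [set x].
Proof.
move=> g h /path_inP[pg gx] /path_inP[_ hx] _ _.
by apply: pcls_eq => // t /set_mem It; rewrite (gx t It) (hx t It).
Qed.

Lemma path_connected1 (x : X) : path_connected R [set x].
Proof.
move=> _ _ -> ->; exists (cst x); split => //.
by apply/path_inP; split => //; exact: is_path_cst.
Qed.

Lemma simply_in_pi1_trivial S : simply_in S -> pi1_trivial_in R S.
Proof.
move=> sS x g gS g0 g1; apply/pcls_eqP; [by case: gS|exact: is_path_cst|].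
apply: sS => //; apply/path_inP; split; first exact: is_path_cst.
by move=> t _; rewrite /= -g0; exact: path_in0 gS.
Qed.

End Deformation.

(** * Radial projection to the sphere *)

Section Radial.
Context {R : realType} {n : nat}.
Implicit Types v : 'rV[R]_n.

Definition nrm v := Num.sqrt (sqn v).

Lemma nrm_ge0 v : 0 <= nrm v. Proof. exact: sqrtr_ge0. Qed.

Lemma sqr_nrm v : nrm v ^+ 2 = sqn v.
Proof. by rewrite sqr_sqrtr// sqn_ge0. Qed.

Lemma nrmZ a v : 0 <= a -> nrm (a *: v) = a * nrm v.
Proof. by move=> a0; rewrite /nrm sqnZ sqrtrM ?sqr_ge0// sqrtr_sqr ger0_norm. Qed.

Lemma closed_diskE v : closed_disk R n v <-> nrm v <= 1.
Proof.
by rewrite /closed_disk /= -/(sqn v) -sqr_nrm expr_le1// nrm_ge0.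
Qed.

Lemma open_diskE v : open_disk R n v <-> nrm v < 1.
Proof.
by rewrite /open_disk /= -/(sqn v) -sqr_nrm expr_lt1// nrm_ge0.
Qed.

Lemma sphereE v : sphere R n v <-> nrm v = 1.
Proof.
rewrite /sphere /= -/(sqn v) -sqr_nrm; split => [/eqP|->]; last by rewrite expr1n.
by rewrite sqrp_eq1 ?nrm_ge0// => /eqP.
Qed.

Lemma nrm_continuous : continuous nrm.
Proof.
move=> v; apply: continuous_comp; first exact: sqn_continuous.
exact: sqrt_continuous.
Qed.

(** The radial projection to the sphere, with value 0 at the center since [0^-1 = 0]. *)
Definition dir v := (nrm v)^-1 *: v.

Lemma nrm_dir v : 0 < nrm v -> nrm (dir v) = 1.
Proof. by move=> v0; rewrite /dir nrmZ ?invr_ge0 ?nrm_ge0// mulVf// gt_eqF. Qed.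

Lemma dir_continuous v : 0 < nrm v -> {for v, continuous dir}.
Proof.
move=> v0; rewrite /dir; apply: (@cvgZ _ _ _ (nbhs v)); last exact: cvg_id.
by apply: cvgV; [rewrite gt_eqF|exact: nrm_continuous].
Qed.

Lemma dir_sphere v : nrm v = 1 -> dir v = v.
Proof. by move=> v1; rewrite /dir v1 invr1 scale1r. Qed.

Lemma line_dir v s : 0 < nrm v -> unit_itv s ->
  nrm (line v (dir v) s) = (1 - s) * nrm v + s /\
  (dir (line v (dir v) s) = dir v).
Proof.
rewrite unit_itvE => v0 /andP[s0 s1].
(* The radial segment from [v] to the sphere consists of positive multiples of [v]. *)
pose mu := (1 - s) + s * (nrm v)^-1.
have i0 : 0 < (nrm v)^-1 by rewrite invr_gt0.
have mu0 : 0 < mu by rewrite /mu; nra.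
have -> : line v (dir v) s = mu *: v.
  by rewrite /line /dir scalerA -scalerDl.
have nE : nrm (mu *: v) = mu * nrm v by rewrite nrmZ// ltW.
split.
  by rewrite nE /mu mulrDl -mulrA mulVf ?mulr1// gt_eqF.
by rewrite /dir nE scalerA invfM mulrAC mulVf ?mul1r// gt_eqF.
Qed.

End Radial.

Section NiceBasis.
Context {R : realType} {X : topologicalType} (C : cw_complex R X).
Variable ord : cw_cell C -> nat.
Hypothesis ord_inj : injective ord.
Hypothesis ord_bd : forall e v, sphere R (cw_dim e) v ->
  exists2 e', (ord e' < ord e)%N & open_cell e' (cw_char e v).
Implicit Types (e : cw_cell C) (n : nat) (O S : set X).
Local Notation I := (@unit_itv R).
Local Notation part := (cw_part ord).

Let hX : hausdorff_space X := cw_hausdorff C.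

Definition cell_inv e (x : X) : 'rV[R]_(cw_dim e) :=
  if pselect (open_cell e x) is left H then sval (cid2 H) else 0.

Lemma cell_invK e v : open_disk R (cw_dim e) v -> cell_inv e (cw_char e v) = v.
Proof.
move=> vD; rewrite /cell_inv; case: pselect => [H|]; last by case; exists v.
by case: cid2 => w /= wD wv; apply: (cw_char_inj (e := e)); rewrite ?in_setE.
Qed.

(** A boundary point of the disk is sent to a cell of smaller rank, so a point of the open cell has
    a single preimage in the closed disk. *)
Lemma open_cell_inj_disk e v w : open_disk R (cw_dim e) v ->
  closed_disk R (cw_dim e) w -> cw_char e w = cw_char e v -> w = v.
Proof.
move=> vD /closed_disk_cases[wD|wS] wv.
  by apply: (cw_char_inj (e := e)); rewrite ?in_setE.
have [e' e'e e'w] := ord_bd wS.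
suff ee : e' = e by rewrite ee ltnn in e'e.
by apply: (open_cell_inj e'w); rewrite wv; exists v.
Qed.

(** What the growth preserves for a fixed open set [O]. The condition on the closure leaves room for
    the next collar; contractibility is weakened to [simply_in] and path connectedness. *)
Record contractible_part n O S : Prop := ContractiblePart {
  cp_sub : S `<=` part n ;
  cp_open : part_open ord n S ;
  cp_closure : closure S `<=` O ;
  cp_simply : @simply_in R X S ;
  cp_connected : path_connected R S }.

Lemma open_disk_open n : open (open_disk R n).
Proof.
have -> : open_disk R n = @sqn R n @^-1` [set x | x < 1] by [].
by apply: open_comp; [move=> v _; exact: sqn_continuous|exact: open_lt].
Qed.

Lemma open_disk_char_cont e v : open_disk R (cw_dim e) v ->
  {for v, continuous (cw_char e)}.
Proof.
move=> vD N vN; have := cw_char_cont_on (open_disk_closed_disk vD) vN.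
have := open_nbhs_nbhs (conj (@open_disk_open _) vD).
by apply: filterS2 => w wD; apply; exact: open_disk_closed_disk.
Qed.

Lemma part_notin_near n y : ~ part n y -> \forall z \near y, ~ part n z.
Proof.
move=> ny; apply: open_nbhs_nbhs; split => //.
by apply: closed_openC; exact: cw_part_closed.
Qed.

(** [S] is the image of a small ball around the preimage of [x], contracted along segments to its
    center. The closed ball [K] also goes into [O], and its compact image contains the closure of
    [S]. *)
Lemma contractible_part_base e x O : open_cell e x -> open O -> O x ->
  exists2 S, contractible_part (ord e).+1 O S & S x.
Proof.
move=> [v0 v0D <-] oO Ov0.
have : \forall v \near v0, open_disk R (cw_dim e) v /\ O (cw_char e v).
  apply: filterI; first exact: open_nbhs_nbhs (conj (@open_disk_open _) v0D).
  exact: (open_disk_char_cont v0D (open_nbhs_nbhs (conj oO Ov0))).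
move=> /nbhs_ballP[r /= r0 rO].
pose K := closed_ball v0 (r / 2).
have r20 : 0 < r / 2 by rewrite divr_gt0.
have KO v : K v -> open_disk R (cw_dim e) v /\ O (cw_char e v).
  move=> Kv; apply: rO; apply: (@closed_ball_subset _ _ v0 (r / 2)) => //.
  by rewrite ltr_pdivrMr// ltr_pMr// ltr1n.
have KD v : K v -> closed_disk R (cw_dim e) v.
  by move=> /KO[+ _]; exact: open_disk_closed_disk.
have cK : compact K.
  apply: (subclosed_compact _ (@closed_disk_compact R (cw_dim e))) => //.
  exact: closed_ball_closed.
have cchiK : cont_on K (cw_char e) := cont_onS KD (@cw_char_cont_on _ _ _ e).
have BK : ball v0 (r / 2) `<=` K by exact: subset_closed_ball.
pose B := ball v0 (r / 2).
have Bv0 : B v0 by exact: ballxx.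
pose S := cw_char e @` B.
have Spart y : S y -> ~ part (ord e) y.
  move=> [v vB <-]; apply: open_cell_notin_part.
  by exists v => //; exact: (KO _ (BK _ vB)).1.
pose rr (p : X * R) := cw_char e (line (cell_inv e p.1) v0 p.2).
have rrE v s : K v -> rr (cw_char e v, s) = cw_char e (line v v0 s).
  by move=> /KO[vD _]; rewrite /rr /= cell_invK.
have crr : cont_on (S `*` I) rr.
  pose q (p : 'rV[R]_(cw_dim e) * R) := (cw_char e p.1, p.2).
  move=> [y s] [/= Sy Is].
  apply: (@cont_atS _ _ _ (q @` (K `*` I))).
    move=> [z t] [/= [v vB <-] It]; exists (v, t) => //=; split => //=; exact: BK.
  (* Since [K] times [I] is compact, continuity is checked in the disk, where the contraction runs
     along segments. *)
  apply: compact_quotient_cont_at.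
  - by apply: hausdorff_prod => //; exact: Rhausdorff.
  - by apply: compact_setX => //; exact: segment_compact.
  - move=> [v t] [/= Kv It]; apply: cont_at_pair; last exact: cont_at_snd.
    apply: (@cont_at_comp _ _ _ _ K fst (cw_char e)); [by move=> ? []|exact: cont_at_fst|].
    exact: cchiK.
  - move=> [v t] [/= Kv It] _.
    apply: (@cont_at_eq _ _ _ (fun p => cw_char e (line p.1 v0 p.2))).
    + by rewrite /= rrE.
    + by move=> [w u] /set_mem[/= Kw _]; rewrite rrE.
    + apply: (@cont_at_comp _ _ _ (K `*` I) (closed_disk R (cw_dim e))
        (fun p : _ * R => line p.1 v0 p.2) (cw_char e)).
      * move=> [w u] [/= Kw Iu]; apply: disk_convex => //; first exact: KD.
        exact: open_disk_closed_disk.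
      * by apply: cont_at_line; [exact: cont_at_fst|
          apply: continuous_cont_at; exact: cvg_cst|exact: cont_at_snd].
      * apply: cw_char_cont_on; apply: disk_convex => //; first exact: KD.
        exact: open_disk_closed_disk.
have rr0 y : S y -> rr (y, 0) = y.
  by move=> [v vB <-]; rewrite rrE ?line0//; exact: BK.
have rr1 y : S y -> [set cw_char e v0] (rr (y, 1)).
  by move=> [v vB <-]; rewrite rrE ?line1//; exact: BK.
have rrS y s : S y -> I s -> S (rr (y, s)).
  move=> [v vB <-] Is; rewrite rrE; last exact: BK.
  by exists (line v v0 s) => //; exact: convex_ball.
exists S; last by exists v0.
split.
- move=> _ [v vB <-]; exists e => //=; exists v => //; exact: (KO _ (BK _ vB)).1.
(* Near [y] the earlier part is avoided, and every preimage in the disk lies in the ball. *)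
- move=> y Sy; have npy := part_notin_near (Spart y Sy).
  have : \forall z \near y, forall k, closed_disk R (cw_dim e) k ->
      cw_char e k = z -> B k.
    apply: compact_fiber_near => //; first exact: closed_disk_compact.
      exact: cw_char_cont_on.
    move=> k kD kz; move: Sy => [v vB vy].
    have -> : k = v.
      by apply: open_cell_inj_disk => //; rewrite ?vy//; exact: (KO _ (BK _ vB)).1.
    have nB : nbhs v B by apply: open_nbhs_nbhs; split => //; exact: ball_open.
    by move: nB; apply: filterS.
  move: npy; apply: filterS2 => z nz hz.
  rewrite (cw_part_ord ord_inj ord_bd) => -[//|[k kD kz]].
  by exists k => //; exact: hz kz.
- have : closed (cw_char e @` K).
    by apply: compact_closed => //; exact: cont_on_compact.
  move=> /closure_id cl y Sy.
  have : (cw_char e @` K) y by rewrite cl; apply: closureS Sy; exact: image_subset.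
  by move=> [v /KO[_ Ov] <-].
- exact: (deformation_simply_in crr rr0 rr1 (@simply_in1 _ _ _)).
- apply: (deformation_path_connected crr rr0 rr1 rrS) => //; last exact: path_connected1.
  by move=> _ ->; exists v0.
Qed.

End NiceBasis.

(** * Extension over a cell by a collar *)

Section NiceBasisStep.
Context {R : realType} {X : topologicalType} (C : cw_complex R X).
Variable ord : cw_cell C -> nat.
Hypothesis ord_inj : injective ord.
Hypothesis ord_bd : forall e v, sphere R (cw_dim e) v ->
  exists2 e', (ord e' < ord e)%N & open_cell e' (cw_char e v).
Implicit Types (e : cw_cell C) (n : nat) (O S : set X).
Local Notation I := (@unit_itv R).
Local Notation part := (cw_part ord).

Let hX : hausdorff_space X := cw_hausdorff C.

(** The boundary points sent to [Z] form a compact set, so one radius serves for all of them. *)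
Lemma collar_radius e O (Z : set X) : open O -> closed Z -> Z `<=` O ->
  exists a : R, [/\ 0 <= a, a < 1 & forall v t, sphere R (cw_dim e) v ->
    Z (cw_char e v) -> a <= t <= 1 -> O (cw_char e (t *: v))].
Proof.
move=> oO cZ ZO.
pose K := closed_disk R (cw_dim e) `&` cw_char e @^-1` Z.
have cK : closed K.
  apply: cont_on_closed => //; last exact: cw_char_cont_on.
  by apply: compact_closed; [exact: norm_hausdorff|exact: closed_disk_compact].
have : compact (sphere R (cw_dim e) `&` K).
  rewrite setIC; apply: (subclosed_compact _ (@closed_disk_compact R (cw_dim e))).
    apply: closedI => //.
    by apply: compact_closed; [exact: norm_hausdorff|exact: sphere_compact].
  by move=> v [[]].
move=> /compact_near_coveringP/near_covering_withinP cvr.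
have : forall v, (sphere R (cw_dim e) `&` K) v ->
    \forall v' \near v & t \near (1 : R), (sphere R (cw_dim e) `&` K) v' ->
      I t -> O (cw_char e (t *: v')).
  move=> v [vS [vD vZ]].
  pose G (p : 'rV[R]_(cw_dim e) * R) := cw_char e (line 0 p.1 p.2).
  have GE w t : G (w, t) = cw_char e (t *: w) by rewrite /G /line scaler0 add0r.
  have cG : cont_on (closed_disk R (cw_dim e) `*` I) G.
    apply: (@cont_on_comp _ _ _ _ (closed_disk R (cw_dim e))
      (fun p : 'rV[R]_(cw_dim e) * R => line 0 p.1 p.2) (cw_char e)) => //.
    - by move=> p [/= p1 p2]; apply: disk_convex => //; exact: closed_disk0.
    - move=> p _; apply: cont_at_line; [|exact: cont_at_fst|exact: cont_at_snd].
      by apply: continuous_cont_at; exact: cvg_cst.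
    - exact: cw_char_cont_on.
  have : nbhs (G (v, 1)) O.
    by rewrite GE scale1r; apply: open_nbhs_nbhs; split => //; exact: ZO.
  move=> /(cG (v, 1) (conj vD unit_itv1)); apply: filterS => -[w t] /= h [wS [wD _]] It.
  by rewrite -GE; exact: h.
move=> /(cvr R (nbhs (1 : R)) (fun t v => I t -> O (cw_char e (t *: v))) _).
move=> /nbhs_ballP[r /= r0 rO].
(* Halving [r] gives the strict inequality [1 - t < r]; the maximum with 0 keeps [t] in [0, 1]. *)
exists (Num.max 0 (1 - r / 2)); split.
- by rewrite le_max lexx.
- by rewrite gt_max ltr01 /= ltrBlDr ltrDl divr_gt0.
- move=> v t vS vZ /andP[]; rewrite ge_max => /andP[t0 tr] t1.
  apply: (rO t _ v); last by rewrite unit_itvE t0.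
    rewrite /ball /= ger0_norm ?subr_ge0//.
    by apply: (@le_lt_trans _ _ (r / 2)); [lra|rewrite ltr_pdivrMr// ltr_pMr// ltr1n].
  by split => //; split => //; exact: sphere_closed_disk.
Qed.

Lemma cont_at_line_dir (n : nat) (A : set ('rV[R]_n * R)) v s : 0 < nrm v ->
  cont_at A (fun p => line p.1 (dir p.1) p.2) (v, s).
Proof.
move=> v0; apply: cont_at_line; [exact: cont_at_fst| |exact: cont_at_snd].
apply: (@cont_at_comp _ _ _ _ setT fst (@dir R n)) => //; first exact: cont_at_fst.
exact/continuous_cont_at/dir_continuous.
Qed.

Lemma closed_disk_line_dir (n : nat) (v : 'rV[R]_n) s :
  closed_disk R n v -> I s -> closed_disk R n (line v (dir v) s).
Proof.
move=> vD Is; apply: disk_convex => //; apply/closed_diskE.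
have [v0|v0] := eqVneq (nrm v) 0.
  by rewrite /dir v0 invr0 scale0r /nrm sqn0 sqrtr0 ler01.
by rewrite nrm_dir// lt_def v0 nrm_ge0.
Qed.

(* The new part is a collar, which retracts radially onto the boundary of the
   new cell. *)
Lemma contractible_part_step n O S : open O -> contractible_part ord n O S ->
  exists2 T, contractible_part ord n.+1 O T & T `&` part n = S.
Proof.
move=> oO [Sn oS clS sS pS].
have [[e en]|nex] := pselect (exists e, ord e = n); last first.
  exists S; last by apply/setIidPl.
  by split => //; rewrite /part_open (cw_part_skip nex).
have [a [a0 a1 aO]] := @collar_radius e O _ oO (@closed_closure _ S) clS.
pose D := closed_disk R (cw_dim e).
(* The collar in the disk: beyond radius [a], over the boundary points sent to [S]. *)
pose Q := [set v : 'rV[R]_(cw_dim e) | [/\ D v, a < nrm v & S (cw_char e (dir v))]].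
pose T := S `|` cw_char e @` Q.
have nrmQ v : Q v -> 0 < nrm v by move=> [_ av _]; exact: le_lt_trans av.
have cchi : cont_on D (cw_char e) := @cw_char_cont_on _ _ _ e.
have part_sphere v : sphere R (cw_dim e) v -> part n (cw_char e v).
  by move=> vS; rewrite -en; exact: sphere_cw_part.
have cellN v : open_disk R (cw_dim e) v -> ~ part n (cw_char e v).
  by move=> vD; rewrite -en; apply: open_cell_notin_part; exists v.
have dirS v : 0 < nrm v -> sphere R (cw_dim e) (dir v).
  by move=> v0; apply/sphereE; exact: nrm_dir.
(* [Q] is saturated: it contains every point of the disk that is sent to [T]. *)
have satQ k : D k -> T (cw_char e k) -> Q k.
  move=> kD; have [kI|kS] := closed_disk_cases kD.
    move=> [/Sn /(cellN k kI)//|[v vQ vk]].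
    have [vD _ _] := vQ.
    by rewrite -(open_cell_inj_disk ord_bd kI vD vk).
  have k1 : nrm k = 1 by exact/sphereE.
  have hQ : S (cw_char e k) -> Q k by move=> Sk; split => //; rewrite ?k1 ?dir_sphere.
  move=> [//|[v vQ vk]]; have [vD _ Sv] := vQ.
  have [vI|vS] := closed_disk_cases vD.
    by exfalso; apply: (cellN v vI); rewrite vk; exact: part_sphere.
  apply: hQ; rewrite -vk; move: Sv; rewrite dir_sphere//; exact/sphereE.
have TI : T `&` part n = S.
  apply/seteqP; split => y; last by move=> Sy; split; [left|exact: Sn].
  move=> [[//|[v vQ <-]] vn]; have [vD _ Sv] := vQ.
  have [/cellN//|/sphereE vS] := closed_disk_cases vD.
  by move: Sv; rewrite dir_sphere.
have Tcell y : T y -> ~ S y -> exists2 v, open_disk R (cw_dim e) v & cw_char e v = y.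
  move=> [//|[v vQ vy]] nS; have [vD _ Sv] := vQ.
  have [vI|/sphereE vS] := closed_disk_cases vD; first by exists v.
  by exfalso; apply: nS; move: Sv; rewrite dir_sphere// vy.
have QoD k : Q k -> \forall w \near k, D w -> Q w.
  move=> kQ; have [kD ak Sk] := kQ; have k0 := nrmQ k kQ.
  have n1 : \forall w \near k, a < nrm w := @nrm_continuous _ _ k _ (lt_nbhsr ak).
  have dD : D (dir k) by exact/sphere_closed_disk/dirS.
  have := cchi _ dD _ (oS _ Sk); move=> /(dir_continuous k0) n2.
  have n2' : \forall w \near k, D (dir w) -> part n (cw_char e (dir w)) ->
      S (cw_char e (dir w)) := n2.
  move: n1 n2'; apply: filterS2 => w aw hw wD; split => //.
  have w0 : 0 < nrm w by exact: le_lt_trans aw.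
  by apply: hw; [exact/sphere_closed_disk/dirS|exact/part_sphere/dirS].
(* Points of the open cell move radially outwards and all others stay. On the sphere both rules
   agree, which gives [rD]. *)
pose r (p : X * R) := if `[< open_cell e p.1 >]
  then let v := cell_inv e p.1 in cw_char e (line v (dir v) p.2) else p.1.
have rI v s : open_disk R (cw_dim e) v ->
    r (cw_char e v, s) = cw_char e (line v (dir v) s).
  move=> vD; rewrite /r /=; case: asboolP => [_|]; last by case; exists v.
  by rewrite cell_invK.
have rP y s : part n y -> r (y, s) = y.
  move=> yn; rewrite /r /=; case: asboolP => // -[v vD vy].
  by exfalso; apply: (cellN v vD); rewrite vy.
have rD v s : D v -> r (cw_char e v, s) = cw_char e (line v (dir v) s).
  move=> /closed_disk_cases[/rI ->//|vS]; rewrite rP; last exact: part_sphere.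
  by rewrite dir_sphere ?lineaa//; exact/sphereE.
have cr : cont_on (T `*` I) r.
  move=> [y s] [/= Ty Is].
  pose q (p : 'rV[R]_(cw_dim e) * R) := (cw_char e p.1, p.2).
  (* The earlier part and the closed cell cover [T]; the deformation is continuous on each of these
     two closed pieces. *)
  apply: (@cont_atS _ _ _ (fst @^-1` part n `|` q @` (D `*` I))).
    move=> [z t] [/= Tz It]; have [zn|zn] := pselect (part n z); first by left.
    right; have [|v vD vz] := Tcell z Tz; first by move=> /Sn.
    by exists (v, t); [split => //; exact: open_disk_closed_disk|rewrite /q /= vz].
  apply: cont_atU.
    have [yn|yn] := pselect (part n y).
      apply: (@cont_at_eq _ _ _ fst); [by rewrite rP| |exact: cont_at_fst].
      by move=> [z t] /set_mem /= zn; rewrite rP.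
    apply: cont_at_out => //; apply: preimage_closed; last exact: cw_part_closed.
    by move=> p _; exact: cvg_fst.
  apply: compact_quotient_cont_at.
  - by apply: hausdorff_prod => //; exact: Rhausdorff.
  - by apply: compact_setX; [exact: closed_disk_compact|exact: segment_compact].
  - move=> [v t] [/= vD It]; apply: cont_at_pair; last exact: cont_at_snd.
    by apply: (@cont_at_comp _ _ _ _ D fst (cw_char e));
      [by move=> ? []|exact: cont_at_fst|exact: cchi].
  - move=> [v t] [/= vD It] [vy ts].
    have v0 : 0 < nrm v by apply/nrmQ/satQ => //; rewrite vy.
    apply: (@cont_at_eq _ _ _ (fun p => cw_char e (line p.1 (dir p.1) p.2))).
    + by rewrite /= rD.
    + by move=> [w u] /set_mem[/= wD _]; rewrite rD.
    + apply: (@cont_at_comp _ _ _ (D `*` I) D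
        (fun p : _ * R => line p.1 (dir p.1) p.2) (cw_char e)).
      * by move=> [w u] [/= wD Iu]; exact: closed_disk_line_dir.
      * exact: cont_at_line_dir.
      * by apply: cchi; exact: closed_disk_line_dir.
have r0 y : T y -> r (y, 0) = y.
  move=> _; have [[v vD <-]|ny] := pselect (open_cell e y).
    by rewrite rI// line0.
  by rewrite /r /=; case: asboolP.
have caseT y : T y -> S y \/ exists2 v, Q v & cw_char e v = y.
  by move=> [Sy|[v vQ <-]]; [left|right; exists v].
have r1 y : T y -> S (r (y, 1)).
  move=> /caseT[Sy|[v vQ <-]]; first by rewrite rP//; exact: Sn.
  by have [vD _ Sv] := vQ; rewrite rD// line1.
have rT y s : T y -> I s -> T (r (y, s)).
  move=> /caseT[Sy|[v vQ <-]] Is; first by rewrite rP; [left|exact: Sn].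
  have [vD av Sv] := vQ; rewrite rD//; right; exists (line v (dir v) s) => //.
  have [lN lD] := line_dir (nrmQ v vQ) Is.
  split; [exact: closed_disk_line_dir| |by rewrite lD].
  have /closed_diskE v1 := vD.
  by rewrite lN; move: Is; rewrite unit_itvE; nra.
exists T => //; split.
- move=> y [/Sn|[v [vD _ _] <-]]; first exact: cw_partS.
  by rewrite -en; apply: (closed_cell_cw_part ord_bd (ltnSn _)); exists v.
- move=> y Ty.
  have n1 : \forall z \near y, forall k, D k -> cw_char e k = z -> Q k.
    apply: compact_fiber_near => //; first exact: closed_disk_compact.
    by move=> k kD ky; apply: QoD; apply: satQ => //; rewrite ky.
  have n2 : \forall z \near y, part n z -> T z.
    have [Sy|nSy] := pselect (S y).
      by move: (oS y Sy); apply: filterS => z h /h; left.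
    have [v vD vy] := Tcell y Ty nSy.
    have := part_notin_near ord_inj ord_bd (cellN v vD); rewrite vy.
    by apply: filterS.
  move: n1 n2; apply: filterS2 => z h1 h2.
  rewrite -en (cw_part_ord ord_inj ord_bd) en => -[/h2//|[k kD kz]].
  by right; exists k => //; exact: h1 kz.
(* [T] lies in the closure of [S] together with the closed collar over that closure. The latter is
   compact, and within [O] by the choice of [a]. *)
- pose K := closed_disk R (cw_dim e) `&` cw_char e @^-1` closure S.
  have cK : compact (sphere R (cw_dim e) `&` K).
    rewrite setIC; apply: (subclosed_compact _ (@closed_disk_compact R (cw_dim e))).
      apply: closedI; last by apply: compact_closed; [exact: norm_hausdorff|exact: sphere_compact].
      apply: cont_on_closed => //; last exact: closed_closure.
      by apply: compact_closed; [exact: norm_hausdorff|exact: closed_disk_compact].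
    by move=> v [[]].
  have cJ : compact `[a, 1] := @segment_compact R a 1.
  pose m (p : 'rV[R]_(cw_dim e) * R) := cw_char e (p.2 *: p.1).
  have cM : compact (m @` ((sphere R (cw_dim e) `&` K) `*` `[a, 1])).
    apply: cont_on_compact; last exact: compact_setX.
    apply: (@cont_on_comp _ _ _ _ D
      (fun p : 'rV[R]_(cw_dim e) * R => p.2 *: p.1) (cw_char e)) => //.
      move=> [v t] [[/= /sphereE vS _]]; rewrite in_itv /= => /andP[at1 t1].
      by apply/closed_diskE; rewrite nrmZ ?vS ?mulr1//; exact: le_trans at1.
    move=> p _; apply: continuous_cont_at.
    by apply: (@cvgZ _ _ _ (nbhs p)); [exact: cvg_snd|exact: cvg_fst].
  have cl : closed (closure S `|` m @` ((sphere R (cw_dim e) `&` K) `*` `[a, 1])).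
    by apply: closedU; [exact: closed_closure|exact: compact_closed].
  have TM : T `<=` closure S `|` m @` ((sphere R (cw_dim e) `&` K) `*` `[a, 1]).
    move=> y /caseT[Sy|[v vQ <-]]; first by left; exact: subset_closure.
    have [vD av Sv] := vQ; have v0 := nrmQ v vQ; have /closed_diskE v1 := vD.
    right; exists (dir v, nrm v).
      split => /=; last by rewrite in_itv /= v1 ltW.
      split; first exact: dirS.
      by split; [exact/sphere_closed_disk/dirS|exact: subset_closure].
    by rewrite /m /= /dir scalerA divff ?scale1r// gt_eqF.
  move=> y /(closureS TM); move/closure_id: cl => <- [/clS//|[[v t] [[/= vS [_ vZ]] + ] <-]].
  by rewrite in_itv /= => at1; exact: aO.
- exact: (deformation_simply_in cr r0 r1 sS).
- by apply: (deformation_path_connected cr r0 r1 rT) => // y; left.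
Qed.

(** [U] is the union of the successive extensions [Q k], and its trace on the part of index [N + k]
    is exactly [Q k]. Hence it is open, and a path in [U], having a compact image, already lies in
    some [Q k]. *)
Lemma cw_nice_nbhs x O : nbhs x O -> exists U, [/\ nice R U, U x & U `<=` O].
Proof.
rewrite nbhsE => -[W [oW Wx] WO].
have [e ex] := open_cellP C x.
have [S0 S0c S0x] := contractible_part_base ord_inj ord_bd ex oW Wx.
pose N := (ord e).+1.
have /choice[F HF] : forall p : nat * set X, exists T,
    contractible_part ord p.1 W p.2 ->
    contractible_part ord p.1.+1 W T /\ T `&` part p.1 = p.2.
  move=> [n S]; have [cS|ncS] := pselect (contractible_part ord n W S).
    by have [T cT TS] := contractible_part_step oW cS; exists T.
  by exists S.
pose Q := fix Q k := if k is k'.+1 then F ((N + k')%N, Q k') else S0.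
have QC k : contractible_part ord (N + k) W (Q k).
  elim: k => [|k IH]; first by rewrite addn0.
  by rewrite addnS; exact: (HF (_, _) IH).1.
have QI k j : (k <= j)%N -> Q j `&` part (N + k) = Q k.
  elim: j => [|j IH]; first by rewrite leqn0 => /eqP ->; apply/setIidPl; exact: (cp_sub (QC 0%N)).
  rewrite leq_eqVlt => /orP[/eqP ->|]; first by apply/setIidPl; exact: cp_sub (QC j.+1).
  rewrite ltnS => kj; rewrite -(IH kj).
  have QjE : Q j.+1 `&` part (N + j) = Q j := (HF (_, _) (QC j)).2.
  rewrite -[in RHS]QjE -setIA; congr (_ `&` _).
  by apply/esym/setIidPr; apply: cw_partS; rewrite leq_add2l.
have QS k j : (k <= j)%N -> Q k `<=` Q j by move=> /QI <- y [].
pose U := \bigcup_k Q k.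
have UI k : U `&` part (N + k) = Q k.
  apply/seteqP; split => y; last first.
    by move=> Qy; split; [exists k|exact: (cp_sub (QC k))].
  move=> [[j _ Qj] yk]; have [kj|/ltnW jk] := leqP k j.
    by rewrite -(QI k j kj).
  exact: QS Qj.
have path_Q (g : R -> X) : path_in U g -> exists k, forall j, (k <= j)%N -> path_in (Q j) g.
  move=> [pg gU].
  have cg : compact (g @` I).
    apply: cont_on_compact; first exact/is_pathP.
    exact: segment_compact.
  have [k gk] := compact_cw_part ord_bd cg.
  exists k => j kj; split => // y gy; rewrite -(UI j); split; first exact: gU.
  by apply: (cw_partS (leq_trans kj (leq_addl _ _))); exact: gk.
have UO : U `<=` O.
  move=> y [k _ Qy]; apply: WO; apply: (cp_closure (QC k)).
  exact: subset_closure.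
exists U; split => //.
- split.
  + apply: (part_open_open ord_inj ord_bd) => n y [Uy yn].
    have yn' : part (N + n) y by exact: (cw_partS (leq_addl _ _)).
    have : Q n y by rewrite -(UI n).
    move=> /(cp_open (QC n)); apply: filterS => z h zn; split => //.
    by exists n => //; apply: h; exact: (cw_partS (leq_addl _ _)).
  + move=> y z [i _ Qy] [j _ Qz].
    have [g [[pg gQ] g0 g1]] := cp_connected (QC (maxn i j))
      (QS _ _ (leq_maxl _ _) _ Qy) (QS _ _ (leq_maxr _ _) _ Qz).
    by exists g; split => //; split => // w /gQ Qw; exists (maxn i j).
  + apply: simply_in_pi1_trivial => g h gU hU.
    have [i gi] := path_Q g gU; have [j hj] := path_Q h hU.
    by apply: (cp_simply (QC (maxn i j))); [exact/gi/leq_maxl|exact/hj/leq_maxr].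
- by exists 0%N.
Qed.

End NiceBasisStep.

Lemma countable_cw_nice_basis (R : realType) (X : topologicalType)
  (C : cw_complex R X) : cw_countable C -> @nice_basis R X.
Proof.
by move=> /countable_cw_order[ord [oi ob]] x O; apply: (cw_nice_nbhs oi ob).
Qed.

(** * Products of countable complexes *)

(** Properties of all sufficiently small sets, measured by the members of [F]. Used as the parameter
    filter in a near-covering, it makes compactness choose a uniform neighborhood. *)
Definition small_filter (T : Type) (F : set_system T) : set_system (set T) :=
  [set Q | exists2 M, F M & forall N, N `<=` M -> Q N].

Lemma small_filter_filter (T : Type) (F : set_system T) :
  Filter F -> Filter (small_filter F).
Proof.
move=> FF; split.
- by exists setT => //; exact: filterT.
- move=> P Q [M FM MP] [N FN NQ]; exists (M `&` N); first exact: filterI.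
  by move=> K KMN; split; [apply: MP|apply: NQ] => x /KMN[].
- by move=> P Q PQ [M FM MP]; exists M => // N /MP /PQ.
Qed.

(** Wallace's theorem. Compactness of [B] gives a tube around each point of [A]; compactness of [A]
    then gives a common neighborhood of [B]. *)
Lemma compact_tube (T S : topologicalType) (A : set T) (B : set S)
    (P : T -> S -> Prop) : compact A -> compact B ->
  (forall a b, A a -> B b -> \forall a' \near a & b' \near b, P a' b') ->
  exists N M, [/\ forall a, A a -> nbhs a N, forall b, B b -> nbhs b M &
    forall a b, N a -> M b -> P a b].
Proof.
move=> /compact_near_coveringP cA /compact_near_coveringP cB PAB.
pose F : set_system S := [set M | forall b, B b -> nbhs b M].
have FF : Filter F.
  split; first by move=> b _; exact: filterT.
    by move=> M N FM FN b Bb; apply: filterI; [exact: FM|exact: FN].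
  by move=> M N MN FM b Bb; apply: filterS MN (FM b Bb).
have step a : A a -> exists N M, [/\ nbhs a N, F M & forall a' b', N a' -> M b' -> P a' b'].
  move=> Aa.
  have [|N aN hN] := cB _ (small_filter (nbhs a))
    (fun N b => \forall b' \near b, forall a', N a' -> P a' b') (small_filter_filter _).
    move=> b Bb; have [[N M] /= [aN bM] NMP] := PAB a b Aa Bb.
    (* The interior is taken because the property at [b'] speaks of a neighborhood of [b']. *)
    exists (M^°, [set N' | N' `<=` N]) => /=.
      by split; [exact: nbhs_interior|exists N].
    move=> [b' N'] /= [bM' NN']; move: bM'; rewrite /interior /=.
    by apply: filterS => b'' Mb'' a' /NN' Na'; exact: (NMP (a', b'')).
  exists N, [set b' | forall a', N a' -> P a' b']; split => //.
    by move=> b Bb; exact: (hN N (@subset_refl _ N) b Bb).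
  by move=> a' b' Na' /(_ a' Na').
have [|M FM hM] := cA _ (small_filter F)
    (fun M a => \forall a' \near a, forall b', M b' -> P a' b') (small_filter_filter _).
  move=> a Aa; have [N [M [aN FM NMP]]] := step a Aa.
  exists (N^°, [set M' | M' `<=` M]) => /=.
    by split; [exact: nbhs_interior|exists M].
  move=> [a' M'] /= [aN' MM']; move: aN'; rewrite /interior /=.
  by apply: filterS => a'' Na'' b' /MM' Mb'; exact: NMP.
exists [set a' | forall b', M b' -> P a' b'], M; split => //.
- by move=> a Aa; exact: (hM M (@subset_refl _ M) a Aa).
- by move=> a b h /h.
Qed.

(** [A] and the part of [L] outside the interior of [N] are disjoint compact sets of a Hausdorff
    space, so they have disjoint neighborhoods. [K] is [L] cut by the closure of the first. *)
Lemma compact_shrink (T : topologicalType) (L A N : set T) : hausdorff_space T ->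
  compact L -> compact A -> (forall a, A a -> nbhs a N) ->
  exists2 K, [/\ compact K, K `<=` L & K `<=` N] &
    forall a, A a -> \forall z \near a, L z -> K z.
Proof.
move=> hT cL cA AN.
have cB : compact (L `&` ~` N^°).
  apply: (subclosed_compact _ cL); last by move=> ? [].
  apply: closedI; first exact: compact_closed.
  by apply: open_closedC; exact: open_interior.
have [|P [M [AP BM PM]]] := compact_tube (P := fun a b => a <> b) cA cB.
  move=> a b Aa [_ Nb].
  have /eqP ab : a <> b by move=> ab; apply: Nb; rewrite -ab; exact: AN.
  move: hT; rewrite open_hausdorff => /(_ _ _ ab)[[U V] /=].
  move=> [/set_mem Ua /set_mem Vb] [oU oV /eqP UV0].
  exists (U, V); first by split; exact: open_nbhs_nbhs.
  move=> [c d] /= [Uc Vd] cd; suff : (U `&` V) c by rewrite UV0.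
  by split => //; rewrite cd.
exists (L `&` closure P).
- split; last 2 first.
  + by move=> ? [].
  + move=> y [Ly Py]; apply: contrapT => Ny.
    have /Py [z [Pz Mz]] : nbhs y M.
      by apply: BM; split => // /interior_subset.
    exact: PM Pz Mz erefl.
  + by apply: compact_closedI => //; exact: closed_closure.
- move=> a /AP; apply: filterS => z Pz Lz; split => //; exact: subset_closure.
Qed.

Lemma near_forall_lt (T : Type) (F : set_system T) 
    (FF : Filter F) (P : nat -> T -> Prop) n :
  (forall i, \forall x \near F, P i x) ->
  \forall x \near F, forall i, (i < n)%N -> P i x.
Proof.
move=> FP; elim: n => [|n IH]; first by apply: filterE.
move: IH (FP n); apply: filterS2 => x h Pn i.
by rewrite ltnS leq_eqVlt => /orP[/eqP ->|/h].
Qed.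

Section ProductCoherent.
Context {R : realType} {X : topologicalType} (C : cw_complex R X).
Local Notation D e := (closed_disk R (cw_dim e)).

Let hX : hausdorff_space X := cw_hausdorff C.

(* Milnor: the product of two countable complexes carries the weak topology.
   Rectangles are grown inside the successive squares of compact parts. *)
Lemma cw_prod_coherent (O : set (X * X)) : cw_countable C ->
  (forall (e f : cw_cell C) u w, D e u -> D f w -> O (cw_char e u, cw_char f w) ->
    \forall p \near (u, w), D e p.1 -> D f p.2 ->
      O (cw_char e p.1, cw_char f p.2)) ->
  open O.
Proof.
move=> /countable_cw_order[ord [oi ob]] hO; rewrite openE => -[x y] Oxy.
pose part := cw_part ord.
have cpart n : compact (part n) by exact: cw_part_compact.
have cellO (e f : cw_cell C) p : O p -> \forall z \near p,
    closed_cell e z.1 -> closed_cell f z.2 -> O z.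
  move=> Op.
  pose q (k : 'rV[R]_(cw_dim e) * 'rV[R]_(cw_dim f)) := (cw_char e k.1, cw_char f k.2).
  have cq : cont_on (D e `*` D f) q.
    move=> [u w] [/= Du Dw]; apply: cont_at_pair.
      apply: (@cont_at_comp _ _ _ _ (D e) fst (cw_char e)); [by move=> ? []|exact: cont_at_fst|].
      exact: cw_char_cont_on.
    apply: (@cont_at_comp _ _ _ _ (D f) snd (cw_char f)); [by move=> ? []|exact: cont_at_snd|].
    exact: cw_char_cont_on.
  have : \forall z \near p, forall k, (D e `*` D f) k -> q k = z -> O (q k).
    apply: compact_fiber_near => //; first exact: hausdorff_prod.
      by apply: compact_setX; exact: closed_disk_compact.
    move=> [u w] [/= Du Dw] quw; have := hO e f u w Du Dw.
    by rewrite -/(q (u, w)) quw => /(_ Op); apply: filterS => -[u' w'] /= h [/h].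
  apply: filterS => -[z1 z2] h /= [u Du uz] [w Dw wz].
  by have := h (u, w) (conj Du Dw); rewrite /q /= uz wz; apply.
have partO n p : O p -> \forall z \near p, part n z.1 -> part n z.2 -> O z.
  move=> Op; pose P i j (z : X * X) := forall e f : cw_cell C,
    ord e = i -> ord f = j -> closed_cell e z.1 -> closed_cell f z.2 -> O z.
  have : \forall z \near p, forall i, (i < n)%N -> forall j, (j < n)%N -> P i j z.
    apply: (@near_forall_lt _ (nbhs p) _ (fun i z => forall j, (j < n)%N -> P i j z)) => i.
    apply: (@near_forall_lt _ (nbhs p) _ (P i)) => j.
    have [[e ei]|ne] := pselect (exists e, ord e = i); last first.
      by apply: filterE => z e f ei; exfalso; apply: ne; exists e.
    have [[f fj]|nf] := pselect (exists f, ord f = j); last first.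
      by apply: filterE => z e' f _ fj; exfalso; apply: nf; exists f.
    have := cellO e f p Op; apply: filterS => z h e' f' e'i f'j.
    have -> : e' = e by apply: oi; rewrite e'i.
    by have -> : f' = f by apply: oi; rewrite f'j.
  apply: filterS => -[z1 z2] h /= [e en ez] [f fn fz].
  by apply: (h _ en _ fn e f) => //; exact: open_cell_sub.
(* The induction is on compact rectangles inside [O]; [next] asks each to be, factor by factor, a
   relative neighborhood of the preceding one. *)
pose good n (AB : set X * set X) := [/\ compact AB.1, compact AB.2,
  AB.1 `<=` part n, AB.2 `<=` part n & AB.1 `*` AB.2 `<=` O].
pose next n (AB AB' : set X * set X) :=
  (forall a, AB.1 a -> \forall z \near a, part n z -> AB'.1 z) /\
  (forall b, AB.2 b -> \forall z \near b, part n z -> AB'.2 z).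
have /choice[F HF] : forall p : nat * (set X * set X), exists AB',
    good p.1 p.2 -> good p.1.+1 AB' /\ next p.1.+1 p.2 AB'.
  move=> [n [A B]]; have [gAB|] := pselect (good n (A, B)); last by exists (A, B).
  have [/= cA cB An Bn ABO] := gAB.
  have [|N [M [AN BM NMO]]] := compact_tube
      (P := fun a b => part n.+1 a -> part n.+1 b -> O (a, b)) cA cB.
    move=> a b Aa Bb; have := partO n.+1 (a, b) (ABO (a, b) (conj Aa Bb)).
    by apply: filterS => -[].
  have [A' [cA' A'n A'N] AA'] := compact_shrink hX (cpart n.+1) cA AN.
  have [B' [cB' B'n B'M] BB'] := compact_shrink hX (cpart n.+1) cB BM.
  exists (A', B') => _; split => //; split => // -[a b] /= [A'a B'b].
  by apply: NMO; [exact: A'N|exact: B'M|exact: A'n|exact: B'n].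
have [m xm] := cw_part_cover ord x; have [m' ym] := cw_part_cover ord y.
pose N := maxn m m'.
pose Q := fix Q k := if k is k'.+1 then F ((N + k')%N, Q k') else ([set x], [set y]).
have QG k : good (N + k)%N (Q k).
  elim: k => [|k IH]; last by rewrite addnS; exact: (HF (_, _) IH).1.
  rewrite addn0; split; try exact: compact_set1.
  - by move=> _ ->; apply: (cw_partS (leq_maxl _ _)).
  - by move=> _ ->; apply: (cw_partS (leq_maxr _ _)).
  - by move=> [a b] /= [-> ->].
have QN k : next (N + k).+1 (Q k) (Q k.+1) := (HF (_, _) (QG k)).2.
have QS k j : (k <= j)%N -> (Q k).1 `<=` (Q j).1 /\ (Q k).2 `<=` (Q j).2.
  elim: j => [|j IH]; first by rewrite leqn0 => /eqP ->; split.
  rewrite leq_eqVlt => /orP[/eqP ->|]; [by split|rewrite ltnS => /IH[h1 h2]].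
  have [_ _ s1 s2 _] := QG j; have [n1 n2] := QN j.
  split => z.
    by move=> /h1 Qz; apply: (nbhs_singleton (n1 z Qz)); exact: (cw_partS (leqnSn _) (s1 _ Qz)).
  by move=> /h2 Qz; apply: (nbhs_singleton (n2 z Qz)); exact: (cw_partS (leqnSn _) (s2 _ Qz)).
(* Each factor is interior to the next one relative to the corresponding part, so the union is open
   in every part. *)
have oU : open (\bigcup_k (Q k).1).
  apply: (part_open_open oi ob) => n z [[k _ Qz] zn].
  have Qz' := (QS _ _ (leq_maxl k n)).1 _ Qz.
  have := (QN (maxn k n)).1 z Qz'; apply: filterS => w h wn; split => //.
  exists (maxn k n).+1 => //; apply: h; apply: cw_partS wn.
  by apply: leqW; apply: leq_trans (leq_maxr k n) (leq_addl _ _).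
have oV : open (\bigcup_k (Q k).2).
  apply: (part_open_open oi ob) => n z [[k _ Qz] zn].
  have Qz' := (QS _ _ (leq_maxl k n)).2 _ Qz.
  have := (QN (maxn k n)).2 z Qz'; apply: filterS => w h wn; split => //.
  exists (maxn k n).+1 => //; apply: h; apply: cw_partS wn.
  by apply: leqW; apply: leq_trans (leq_maxr k n) (leq_addl _ _).
exists (\bigcup_k (Q k).1, \bigcup_k (Q k).2).
  by split; apply: open_nbhs_nbhs; split => //; exists 0%N.
move=> [a b] /= [[i _ Qa] [j _ Qb]].
have [_ _ _ _] := QG (maxn i j); apply; split => /=.
- exact: (QS _ _ (leq_maxl i j)).1.
- exact: (QS _ _ (leq_maxr i j)).2.
Qed.

End ProductCoherent.

(** * A homeomorphism from the disk to a product of disks *)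

Section DiskProduct.
Context {R : realType} {m n : nat}.
Implicit Types v w : 'rV[R]_(m + n).

Lemma sqn_split v : sqn v = sqn (lsubmx v) + sqn (rsubmx v).
Proof.
by rewrite /sqn big_split_ord /=; congr (_ + _); apply: eq_bigr => i _; rewrite mxE.
Qed.

(** The norm whose unit ball is the product of the two disks. Rescaling each ray by
    [nrm v / gauge v] sends the Euclidean disk onto that product. *)
Definition gauge v := Num.max (nrm (lsubmx v)) (nrm (rsubmx v)).

Lemma gauge_ge0 v : 0 <= gauge v.
Proof. by rewrite le_max nrm_ge0. Qed.

Lemma gaugeZ a v : 0 <= a -> gauge (a *: v) = a * gauge v.
Proof. by move=> a0; rewrite /gauge !linearZ /= !nrmZ// maxr_pMr. Qed.

(** The factor sqrt 2 would do; 2 avoids the root and suffices to bound [dscale]. *)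
Lemma nrm_gauge v : nrm v <= 2 * gauge v.
Proof.
have g0 := gauge_ge0 v.
rewrite -(@ler_pXn2r _ 2)// ?nnegrE ?nrm_ge0 ?mulr_ge0// sqr_nrm sqn_split -!sqr_nrm.
have l0 := nrm_ge0 (lsubmx v); have r0 := nrm_ge0 (rsubmx v).
have lg : nrm (lsubmx v) <= gauge v by rewrite le_max lexx.
have rg : nrm (rsubmx v) <= gauge v by rewrite le_max lexx orbT.
nra.
Qed.

Lemma gauge_eq0 v : gauge v = 0 -> v = 0.
Proof.
move=> g0; apply: sqn_eq0; rewrite -sqr_nrm.
have /le_anti -> : nrm v <= 0 <= nrm v.
  by rewrite nrm_ge0 andbT; have := nrm_gauge v; rewrite g0 mulr0.
by rewrite expr0n.
Qed.

(* At [v = 0] the quotient is [0 / 0 = 0]. *)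
Definition dscale v := nrm v / gauge v.
Definition hleft v : 'rV[R]_m := dscale v *: lsubmx v.
Definition hright v : 'rV[R]_n := dscale v *: rsubmx v.

Lemma dscale_ge0 v : 0 <= dscale v.
Proof. by rewrite divr_ge0 ?nrm_ge0 ?gauge_ge0. Qed.

Lemma dscale_le2 v : dscale v <= 2.
Proof.
have [g0|g0] := eqVneq (gauge v) 0; first by rewrite /dscale g0 invr0 mulr0.
by rewrite ler_pdivrMr ?nrm_gauge// lt_def g0 gauge_ge0.
Qed.

(** The gauge of the image is the Euclidean norm of [v]; the statements on closed disks, open disks
    and spheres follow. *)
Lemma nrm_hmap v : Num.max (nrm (hleft v)) (nrm (hright v)) = nrm v.
Proof.
rewrite !nrmZ ?dscale_ge0// -maxr_pMr ?dscale_ge0// -/(gauge v) /dscale.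
have [g0|g0] := eqVneq (gauge v) 0; last by rewrite divfK.
by rewrite g0 mulr0 (gauge_eq0 g0) /nrm sqn0 sqrtr0.
Qed.

Lemma hmap_inj v w : hleft v = hleft w -> hright v = hright w -> v = w.
Proof.
move=> hl hr; have nE : nrm v = nrm w by rewrite -!nrm_hmap hl hr.
have e : dscale v *: v = dscale w *: w.
  have E u : dscale u *: u = row_mx (hleft u) (hright u).
    by rewrite -{2}[u]hsubmxK scale_row_mx.
  by rewrite !E hl hr.
have [v0|v0] := eqVneq (nrm v) 0.
  have z u : nrm u = 0 -> u = 0 :> 'rV[R]_(m + n).
    by move=> u0; apply: sqn_eq0; rewrite -sqr_nrm u0 expr0n.
  by rewrite (z v)// (z w)// -nE.
have pos u : nrm u != 0 -> 0 < gauge u.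
  move=> u0; rewrite lt_def gauge_ge0 andbT.
  by apply: contra_neq u0 => /gauge_eq0 ->; rewrite /nrm sqn0 sqrtr0.
have spos u : nrm u != 0 -> 0 < dscale u.
  by move=> u0; rewrite divr_gt0 ?pos// lt_def u0 nrm_ge0.
have w0 : nrm w != 0 by rewrite -nE.
have : dscale v = dscale w.
  have := congr1 nrm e; rewrite !nrmZ ?dscale_ge0// nE.
  by move=> /(mulIf w0).
move=> se; move: e; rewrite se => /scalerI; apply.
by rewrite gt_eqF// spos.
Qed.

Lemma hmap_surj (a : 'rV[R]_m) (b : 'rV[R]_n) :
  exists v, hleft v = a /\ hright v = b.
Proof.
pose z := row_mx a b.
have [z0|z0] := eqVneq (nrm z) 0.
  have e : z = 0 by apply: sqn_eq0; rewrite -sqr_nrm z0 expr0n.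
  have [a0 b0] : a = 0 /\ b = 0.
    by split; [rewrite -(row_mxKl a b)|rewrite -(row_mxKr a b)];
      rewrite -/z e linear0.
  by exists 0; rewrite /hleft /hright !linear0 ?scaler0 a0 b0.
have g0 : gauge z != 0.
  by apply: contra_neq z0 => /gauge_eq0 ->; rewrite /nrm sqn0 sqrtr0.
(* [dscale] is constant along rays, so dividing by its value at [z] inverts the map. *)
pose k := gauge z / nrm z.
have k0 : 0 < k.
  by rewrite divr_gt0// lt_def ?g0 ?z0 ?gauge_ge0 ?nrm_ge0.
exists (k *: z).
have e : dscale (k *: z) * k = 1.
  rewrite /dscale nrmZ ?gaugeZ ?ltW// /k.
  by field; rewrite z0 g0.
have lZ : lsubmx (k *: z) = k *: a by rewrite linearZ /= row_mxKl.
have rZ : rsubmx (k *: z) = k *: b by rewrite linearZ /= row_mxKr.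
by rewrite /hleft /hright lZ rZ !scalerA e !scale1r.
Qed.

Lemma lsubmx_continuous : continuous (lsubmx : 'rV[R]_(m + n) -> 'rV[R]_m).
Proof.
move=> v N /nbhs_ballP[r /= r0 rN]; apply/nbhs_ballP; exists r => //= w [_ vw].
by apply: rN; split => // i j; rewrite !mxE.
Qed.

Lemma rsubmx_continuous : continuous (rsubmx : 'rV[R]_(m + n) -> 'rV[R]_n).
Proof.
move=> v N /nbhs_ballP[r /= r0 rN]; apply/nbhs_ballP; exists r => //= w [_ vw].
by apply: rN; split => // i j; rewrite !mxE.
Qed.

Lemma gauge_continuous : continuous gauge.
Proof.
move=> v; apply: (@continuous_max _ _ (fun v => nrm (lsubmx v)) (fun v => nrm (rsubmx v)) v).
  by apply: continuous_comp; [exact: lsubmx_continuous|exact: nrm_continuous].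
by apply: continuous_comp; [exact: rsubmx_continuous|exact: nrm_continuous].
Qed.

Lemma dscale_continuous_at v : gauge v != 0 -> {for v, continuous dscale}.
Proof.
move=> g0; apply: (@cvgM _ _ (nbhs v)); first exact: nrm_continuous.
by apply: cvgV => //; exact: gauge_continuous.
Qed.

(** [dscale] need not be continuous at 0, but it is bounded by 2 and [f] tends to 0 there. *)
Lemma dscale_Z_continuous k (f : 'rV[R]_(m + n) -> 'rV[R]_k) : continuous f ->
  (forall w (r : R), ball 0 r w -> ball 0 r (f w)) -> f 0 = 0 ->
  continuous (fun v => dscale v *: f v).
Proof.
move=> cf fball f0 v; have [g0|g0] := eqVneq (gauge v) 0; last first.
  by apply: (@cvgZ _ _ _ (nbhs v)); [exact: dscale_continuous_at|exact: cf].
rewrite (gauge_eq0 g0) => N; rewrite /= f0 scaler0 => /nbhs_ballP[r /= r0 rN].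
apply/nbhs_ballP; exists (r / 2); first by rewrite /= divr_gt0.
move=> w /= /fball [_ fw]; apply: rN; split => // i j; have := fw i j.
rewrite /ball /= !mxE !sub0r !normrN normrM => fr.
apply: le_lt_trans (_ : 2 * `|f w i j| < r); last by lra.
by rewrite ler_wpM2r// ger0_norm ?dscale_ge0 ?dscale_le2.
Qed.

Lemma hleft_continuous : continuous hleft.
Proof.
apply: dscale_Z_continuous; [exact: lsubmx_continuous| |exact: linear0].
by move=> w r [r0 wr]; split => // i j; have := wr i (lshift n j); rewrite !mxE.
Qed.

Lemma hright_continuous : continuous hright.
Proof.
apply: dscale_Z_continuous; [exact: rsubmx_continuous| |exact: linear0].
by move=> w r [r0 wr]; split => // i j; have := wr i (rshift m j); rewrite !mxE.
Qed.

Lemma hmap_closed v : closed_disk R (m + n) v <->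
  closed_disk R m (hleft v) /\ closed_disk R n (hright v).
Proof.
rewrite !closed_diskE -nrm_hmap ge_max.
by split => [/andP[]//|[-> ->]].
Qed.

Lemma hmap_open v : open_disk R (m + n) v <->
  open_disk R m (hleft v) /\ open_disk R n (hright v).
Proof.
rewrite !open_diskE -nrm_hmap gt_max.
by split => [/andP[]//|[-> ->]].
Qed.

Lemma hmap_sphere v : sphere R (m + n) v ->
  sphere R m (hleft v) \/ sphere R n (hright v).
Proof.
rewrite !sphereE -nrm_hmap; have [_|_] := leP (nrm (hleft v)) (nrm (hright v)).
  by move=> ->; right.
by move=> ->; left.
Qed.

End DiskProduct.

(** * The CW structure of Pi(X) *)

Section Lifts.
Context {R : realType} {X : topologicalType} (C : cw_complex R X).
Hypothesis nbX : @nice_basis R X.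
Implicit Types (e f : cw_cell C) (c z : Pi R X).
Local Notation D e := (closed_disk R (cw_dim e)).

Let hX : hausdorff_space X := cw_hausdorff C.

Definition eseg e (u v : 'rV[R]_(cw_dim e)) : Pi R X := pseg (cw_char e) u v.

Let D0 e : D e 0. Proof. exact: closed_disk0. Qed.

Section OneCell.
Variable e : cw_cell C.
Implicit Types u v w : 'rV[R]_(cw_dim e).

Lemma psrc_eseg u v : D e u -> D e v -> psrc (eseg u v) = cw_char e u.
Proof. exact: (psrc_seg (@disk_convex _ _) (@cw_char_cont_on _ _ _ e)). Qed.

Lemma ptgt_eseg u v : D e u -> D e v -> ptgt (eseg u v) = cw_char e v.
Proof. exact: (ptgt_seg (@disk_convex _ _) (@cw_char_cont_on _ _ _ e)). Qed.

Lemma eseg_mul u v w : D e u -> D e v -> D e w ->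
  pmul (eseg u v) (eseg v w) = eseg u w.
Proof. exact: (pmul_seg (@disk_convex _ _) (@cw_char_cont_on _ _ _ e)). Qed.

Lemma eseg_id u : eseg u u = pid (cw_char e u).
Proof. exact: psegaa. Qed.

Lemma near_eseg u0 (U : set X) : D e u0 -> nice R U -> U (cw_char e u0) ->
  \forall u \near u0, D e u -> [/\ U (cw_char e u),
    eseg u u0 = plocal U (cw_char e u) (cw_char e u0) &
    eseg u0 u = plocal U (cw_char e u0) (cw_char e u)].
Proof. exact: (near_seg (@disk_convex _ _) (@cw_char_cont_on _ _ _ e)). Qed.

End OneCell.

(* The characteristic map of the product of [e] and [f], lifted to Pi(X) so that
   the centers of the disks go to [c]. *)
Definition cell_lift e f c u w : Pi R X := pconj (eseg (e := e) u 0) c (eseg (e := f) 0 w).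

Definition centered e f c := psrc c = cw_char e 0 /\ ptgt c = cw_char f 0.

Section TwoCells.
Variables e f : cw_cell C.
Implicit Types (u : 'rV[R]_(cw_dim e)) (w : 'rV[R]_(cw_dim f)).

Lemma psrc_lift c u w : centered e f c -> D e u -> D f w ->
  psrc (cell_lift c u w) = cw_char e u.
Proof.
by move=> [sc tc] Du Dw; rewrite psrc_conj ?psrc_eseg ?ptgt_eseg.
Qed.

Lemma ptgt_lift c u w : centered e f c -> D e u -> D f w ->
  ptgt (cell_lift c u w) = cw_char f w.
Proof.
by move=> [sc tc] Du Dw; rewrite ptgt_conj ?psrc_eseg ?ptgt_eseg.
Qed.

Lemma lift_move c u u' w w' : centered e f c -> D e u -> D e u' -> D f w -> D f w' ->
  pconj (eseg u' u) (cell_lift c u w) (eseg w w') = cell_lift c u' w'.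
Proof.
move=> [sc tc] Du Du' Dw Dw'.
by rewrite /cell_lift pconj_conj ?psrc_eseg ?ptgt_eseg// !eseg_mul.
Qed.

Lemma lift0 c : centered e f c -> cell_lift (e := e) (f := f) c 0 0 = c.
Proof. by move=> [sc tc]; rewrite /cell_lift !eseg_id -sc -tc pconj1. Qed.

Definition recenter u w z : Pi R X := pconj (eseg 0 u) z (eseg w 0).

Lemma recenter_lift c u w : centered e f c -> D e u -> D f w ->
  recenter u w (cell_lift c u w) = c.
Proof. by move=> cc Du Dw; rewrite /recenter lift_move// lift0. Qed.

Lemma centered_recenter u w z : D e u -> D f w ->
  psrc z = cw_char e u -> ptgt z = cw_char f w -> centered e f (recenter u w z).
Proof.
move=> Du Dw sz tz.
by split; rewrite ?psrc_conj ?ptgt_conj ?psrc_eseg ?ptgt_eseg.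
Qed.

Lemma lift_recenter u w z : D e u -> D f w ->
  psrc z = cw_char e u -> ptgt z = cw_char f w -> cell_lift (recenter u w z) u w = z.
Proof.
move=> Du Dw sz tz.
rewrite /cell_lift pconj_conj ?psrc_eseg ?ptgt_eseg// !eseg_mul// !eseg_id.
by rewrite -sz -tz pconj1.
Qed.

(** By [near_eseg], moving the ends slightly within their cells moves the lift inside the sheet
    through it. *)
Lemma lift_cont_on c : centered e f c ->
  cont_on (D e `*` D f) (fun p => cell_lift (e := e) (f := f) c p.1 p.2).
Proof.
move=> cc [u0 w0] [/= Du0 Dw0] N zN.
have [U [V [nU nV Uz Vz UVN]]] := nbhs_PiP nbX zN.
rewrite psrc_lift// in Uz; rewrite ptgt_lift// in Vz.
have nu := near_eseg Du0 nU Uz; have nw := near_eseg Dw0 nV Vz.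
exists ([set u | D e u -> [/\ U (cw_char e u),
    eseg u u0 = plocal U (cw_char e u) (cw_char e u0) &
    eseg u0 u = plocal U (cw_char e u0) (cw_char e u)]],
  [set w | D f w -> [/\ V (cw_char f w),
    eseg w w0 = plocal V (cw_char f w) (cw_char f w0) &
    eseg w0 w = plocal V (cw_char f w0) (cw_char f w)]]) => //.
move=> [u w] /= [hu hw] [Du Dw]; apply: UVN.
have [Uu us _] := hu Du; have [Vw _ ws] := hw Dw.
split; rewrite ?psrc_lift ?ptgt_lift//.
by rewrite -us -ws lift_move.
Qed.

End TwoCells.

(* The comparisons of the centers of two cells along their common points. *)
Definition cell_glue e e' : set (Pi R X) := [set z | exists u u',
  [/\ D e u, D e' u', cw_char e u = cw_char e' u' & z = pmul (eseg (e := e') 0 u') (eseg u 0)]].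

(* The class is locally constant in the pair of points, which lies in a compact set. *)
Lemma finite_glue e e' : finite_set (cell_glue e e').
Proof.
pose A (p : 'rV[R]_(cw_dim e) * 'rV[R]_(cw_dim e')) : set (Pi R X) :=
  [set z | cw_char e p.1 = cw_char e' p.2 /\ z = pmul (eseg 0 p.2) (eseg p.1 0)].
have : finite_set (\bigcup_(p in D e `*` D e') A p).
  apply: compact_bigcup_finite.
    by apply: compact_setX; exact: closed_disk_compact.
  move=> [u0 u0'] [/= Du0 Du0'].
  have [eq|/eqP neq] := pselect (cw_char e u0 = cw_char e' u0').
    exists [set pmul (eseg 0 u0') (eseg u0 0)]; split => //.
    have [U [nU Uu _]] := nbX (x := cw_char e u0) (O := setT) filterT.
    have Uu' : U (cw_char e' u0') by rewrite -eq.
    exists ([set u | D e u -> [/\ U (cw_char e u),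
        eseg u u0 = plocal U (cw_char e u) (cw_char e u0) &
        eseg u0 u = plocal U (cw_char e u0) (cw_char e u)]],
      [set w | D e' w -> [/\ U (cw_char e' w),
        eseg w u0' = plocal U (cw_char e' w) (cw_char e' u0') &
        eseg u0' w = plocal U (cw_char e' u0') (cw_char e' w)]]).
      by split; exact: near_eseg.
    move=> [u u'] /= [hu hu'] [Du Du'] z [/= uu' ->].
    have [Uu1 us _] := hu Du; have [Uu1' _ us'] := hu' Du'.
    rewrite -(eseg_mul (D0 e') Du0' Du') -(eseg_mul Du Du0 (D0 e)).
    rewrite pmulA ?psrc_mul ?psrc_eseg ?ptgt_eseg//.
    rewrite -[pmul (eseg u0' u') _]pmulA ?psrc_eseg ?ptgt_eseg//.
    rewrite us us' uu' -eq plocal_mul// plocal_id//.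
    by rewrite pmul1l// psrc_eseg.
  (* Points with distinct images are separated, so nearby pairs contribute no class. *)
  exists set0; split => //.
  move: hX; rewrite open_hausdorff => /(_ _ _ neq)[[U V] /=].
  move=> [/set_mem Uu /set_mem Vu'] [oU oV /eqP UV0].
  have nU := cw_char_cont_on Du0 (open_nbhs_nbhs (conj oU Uu)).
  have nV := cw_char_cont_on Du0' (open_nbhs_nbhs (conj oV Vu')).
  exists ([set u | D e u -> U (cw_char e u)], [set w | D e' w -> V (cw_char e' w)]) => //.
  move=> [u u'] /= [hu hu'] [Du Du'] z [/= uu' _].
  suff : (U `&` V) (cw_char e u) by rewrite UV0.
  by split; [exact: hu|rewrite uu'; exact: hu'].
apply: sub_finite_set => z [u [u' [Du Du' uu' ->]]].
by exists (u, u').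
Qed.

(** The change of coordinates between lifted cells with a common point: their centers differ by one
    gluing class at each end. With [finite_glue], only finitely many centers are possible over two
    given cells. *)
Lemma recenter_lift_glue e f e' f' c (u : 'rV[R]_(cw_dim e)) (w : 'rV[R]_(cw_dim f))
    (u' : 'rV[R]_(cw_dim e')) (w' : 'rV[R]_(cw_dim f')) :
  centered e f c -> D e u -> D f w -> D e' u' -> D f' w' ->
  cw_char e u = cw_char e' u' -> cw_char f w = cw_char f' w' ->
  exists a b, [/\ cell_glue e e' a, cell_glue f' f b &
    recenter u' w' (cell_lift c u w) = pconj a c b].
Proof.
move=> [sc tc] Du Dw Du' Dw' uu' ww'.
exists (pmul (eseg 0 u') (eseg u 0)), (pmul (eseg 0 w) (eseg w' 0)); split.
- by exists u, u'.
- by exists w', w.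
- by rewrite /recenter /cell_lift pconj_conj// ?psrc_eseg ?ptgt_eseg.
Qed.

End Lifts.

Section PiCW.
Context {R : realType} {X : topologicalType} (C : cw_complex R X).
Hypothesis cC : cw_countable C.
Local Notation D e := (closed_disk R (cw_dim e)).
Local Notation B e := (open_disk R (cw_dim e)).

Let nbX : @nice_basis R X := countable_cw_nice_basis cC.
Let hX : hausdorff_space X := cw_hausdorff C.

Definition pi_cell := {p : cw_cell C * cw_cell C * Pi R X | centered p.1.1 p.1.2 p.2}.

Definition pi_left (x : pi_cell) := (sval x).1.1.
Definition pi_right (x : pi_cell) := (sval x).1.2.
Definition pi_center (x : pi_cell) := (sval x).2.
Definition pi_dim (x : pi_cell) := (cw_dim (pi_left x) + cw_dim (pi_right x))%N.

Definition pi_char (x : pi_cell) (v : 'rV[R]_(pi_dim x)) : Pi R X :=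
  cell_lift (e := pi_left x) (f := pi_right x) (pi_center x) (hleft v) (hright v).

Definition mk_cell e f c (cc : centered e f c) : pi_cell :=
  exist (fun p : cw_cell C * cw_cell C * Pi R X => centered p.1.1 p.1.2 p.2) (e, f, c) cc.

Lemma pi_centered x : centered (pi_left x) (pi_right x) (pi_center x).
Proof. exact: (proj2_sig x). Qed.

Lemma pi_cell_inj (x y : pi_cell) : sval x = sval y -> x = y.
Proof. by case: x y => [p hp] [q hq] /= pq; subst q; congr exist; exact: Prop_irrelevance. Qed.

Lemma psrc_pi_char (x : pi_cell) (v : 'rV[R]_(pi_dim x)) : closed_disk R _ v ->
  psrc (pi_char v) = cw_char (pi_left x) (hleft v).
Proof. by move=> /hmap_closed[Dl Dr]; rewrite psrc_lift//; exact: pi_centered. Qed.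

Lemma ptgt_pi_char (x : pi_cell) (v : 'rV[R]_(pi_dim x)) : closed_disk R _ v ->
  ptgt (pi_char v) = cw_char (pi_right x) (hright v).
Proof. by move=> /hmap_closed[Dl Dr]; rewrite ptgt_lift//; exact: pi_centered. Qed.

Lemma pi_char_cont x : cont_on (closed_disk R (pi_dim x)) (@pi_char x).
Proof.
apply: (@cont_on_comp _ _ _ _ (D (pi_left x) `*` D (pi_right x))
  (fun v => (hleft v, hright v))
  (fun p => cell_lift (e := pi_left x) (f := pi_right x) (pi_center x) p.1 p.2)).
- by move=> v /hmap_closed.
- by move=> v _; apply: cont_at_pair; apply: continuous_cont_at;
    [exact: hleft_continuous|exact: hright_continuous].
- exact: (lift_cont_on nbX (pi_centered x)).
Qed.

Lemma lift_pi_char e f c (cc : centered e f c) u w : D e u -> D f w ->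
  exists2 v, closed_disk R (pi_dim (mk_cell cc)) v & pi_char v = cell_lift c u w.
Proof.
move=> Du Dw; have [v [vl vr]] := hmap_surj u w.
exists v; first by apply/hmap_closed; rewrite vl vr.
by rewrite /pi_char /= vl vr.
Qed.

Lemma lift_pi_char_open e f c (cc : centered e f c) u w : B e u -> B f w ->
  exists2 v, open_disk R (pi_dim (mk_cell cc)) v & pi_char v = cell_lift c u w.
Proof.
move=> Bu Bw; have [v [vl vr]] := hmap_surj u w.
exists v; first by apply/hmap_open; rewrite vl vr.
by rewrite /pi_char /= vl vr.
Qed.

(** The two ends of the lifted class already determine both components of [v]. *)
Lemma pi_char_inj x : set_inj (open_disk R (pi_dim x)) (@pi_char x).
Proof.
move=> v w /set_mem vB /set_mem wB vw.
have vD := open_disk_closed_disk vB; have wD := open_disk_closed_disk wB.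
have [vl vr] := (hmap_open v).1 vB; have [wl wr] := (hmap_open w).1 wB.
apply: hmap_inj.
  apply: (cw_char_inj (mem_set vl) (mem_set wl)).
  by have := psrc_pi_char vD; rewrite vw => <-; rewrite (psrc_pi_char wD).
apply: (cw_char_inj (mem_set vr) (mem_set wr)).
by have := ptgt_pi_char vD; rewrite vw => <-; rewrite (ptgt_pi_char wD).
Qed.

(** The open cells through the two ends of [z] give [e] and [f], and recentering [z] gives the
    class. *)
Lemma pi_partition z : exists! x, (@pi_char x @` open_disk R (pi_dim x)) z.
Proof.
have [e [u Bu ue]] := open_cellP C (psrc z).
have [f [w Bw wf]] := open_cellP C (ptgt z).
have Du := open_disk_closed_disk Bu; have Dw := open_disk_closed_disk Bw.
have cc : centered e f (recenter u w z) by apply: centered_recenter.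
exists (mk_cell cc); split.
  have [v vB vE] := lift_pi_char_open cc Bu Bw.
  by exists v => //; rewrite vE lift_recenter.
move=> [[[e' f'] c'] cc'] [v vB vz]; apply: pi_cell_inj => /=.
have vD := open_disk_closed_disk vB; have [vl vr] := (hmap_open v).1 vB.
have sv := psrc_pi_char vD; have tv := ptgt_pi_char vD.
rewrite vz /pi_left /pi_right /= in sv tv vl vr.
have ee : e' = e by apply: (@open_cell_inj _ _ C _ _ (psrc z)); [exists (hleft v)|exists u].
have ff : f' = f by apply: (@open_cell_inj _ _ C _ _ (ptgt z)); [exists (hright v)|exists w].
subst e' f'; congr pair.
have ul : hleft v = u.
  by apply: (cw_char_inj (e := e)); rewrite ?in_setE// ue.
have wr : hright v = w.
  by apply: (cw_char_inj (e := f)); rewrite ?in_setE// wf.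
rewrite -vz /pi_char /pi_center /= ul wr.
by apply: recenter_lift.
Qed.

(** A boundary point of a product of disks may have only one component on a sphere. So the dimension
    has to drop there, and must not grow for the other component. *)
Lemma disk_carrier (e : cw_cell C) : exists2 E : set (cw_cell C), finite_set E &
  forall u, D e u -> exists e' (u' : 'rV[R]_(cw_dim e')),
    [/\ E e', B e' u', cw_char e u = cw_char e' u', (cw_dim e' <= cw_dim e)%N &
        sphere R (cw_dim e) u -> (cw_dim e' < cw_dim e)%N].
Proof.
have [F [fF dF bF]] := cw_closure_finite e.
exists (e |` F); first by rewrite finite_setU; split => //; exact: finite_set1.
move=> u /closed_disk_cases[uB|uS].
  exists e, u; split => //; first by left.
  by move: uB; rewrite /open_disk /sphere /= => + h; rewrite h ltxx.
have [|e' Fe' [u' Bu' u'u]] := bF (cw_char e u); first by exists u.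
by exists e', u'; split => //; [right|exact/ltnW/dF|move=> _; exact: dF].
Qed.

(** Serves closure finiteness, with gluing classes in [A] and [A'], and local finiteness, with the
    classes over the preimages of a point. *)
Lemma finite_pi_cells (E F : set (cw_cell C)) (A : cw_cell C -> set (Pi R X))
    (A' : cw_cell C -> set (Pi R X)) c : finite_set E -> finite_set F ->
  (forall e, E e -> finite_set (A e)) -> (forall e, F e -> finite_set (A' e)) ->
  finite_set [set x : pi_cell | [/\ E (pi_left x), F (pi_right x) & exists a b,
    [/\ A (pi_left x) a, A' (pi_right x) b & pi_center x = pconj a c b]]].
Proof.
move=> fE fF fA fA'.
pose Z := \bigcup_(p in E `*` F)
  [set (p, z) | z in (fun q : Pi R X * Pi R X => pconj q.1 c q.2) @` (A p.1 `*` A' p.2)].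
have fZ : finite_set Z.
  apply: bigcup_finite; first exact: finite_setX.
  move=> p [Ep Fp]; apply/finite_image/finite_image.
  by apply: finite_setX; [exact: fA|exact: fA'].
apply: (@sub_finite_set _ _ ((fun x : pi_cell => sval x) @^-1` Z)).
  move=> [[[e f] c'] cc] [/= Ee Ff [a [b [Aa Ab c'E]]]].
  exists (e, f); first by split.
  by exists c' => //; exists (a, b).
apply: finite_preimage => // x y _ _; exact: pi_cell_inj.
Qed.

Lemma pi_closure_finite x : exists F : set pi_cell,
  [/\ finite_set F, (forall y, F y -> (pi_dim y < pi_dim x)%N) &
      @pi_char x @` sphere R (pi_dim x) `<=`
        \bigcup_(y in F) (@pi_char y @` open_disk R (pi_dim y))].
Proof.
case: x => [[[e f] c] cc] /=.
have [E fE hE] := disk_carrier e; have [F fF hF] := disk_carrier f.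
have fS := @finite_pi_cells E F (fun e' => cell_glue e e') (fun f' => cell_glue f' f) c fE fF
  (fun e' _ => finite_glue nbX e e') (fun f' _ => finite_glue nbX f' f).
set S := [set x | _] in fS.
exists (S `&` [set y | (pi_dim y < cw_dim e + cw_dim f)%N]); split.
- by apply: sub_finite_set fS => y [].
- by move=> y [].
- move=> _ [v vS <-]; rewrite /pi_dim /= in v vS *.
  have vD := sphere_closed_disk vS.
  have [Dl Dr] := (hmap_closed v).1 vD.
  have [e' [u' [Ee' Bu' uu' le lte]]] := hE _ Dl.
  have [f' [w' [Ff' Bw' ww' lf ltf]]] := hF _ Dr.
  have Du' := open_disk_closed_disk Bu'; have Dw' := open_disk_closed_disk Bw'.
  set z := pi_char _.
  have zE : z = cell_lift c (hleft v) (hright v) by [].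
  have sz : psrc z = cw_char e' u' by rewrite zE psrc_lift.
  have tz : ptgt z = cw_char f' w' by rewrite zE ptgt_lift.
  have cc' := centered_recenter Du' Dw' sz tz.
  exists (mk_cell cc').
    split; last first.
      rewrite /= /pi_dim /=; have [/lte h|/ltf h] := hmap_sphere vS.
        by rewrite -addSn leq_add.
      by rewrite -addnS leq_add.
    split => //=; have [a [b [ga gb ab]]] :=
      recenter_lift_glue cc Dl Dr Du' Dw' uu' ww'.
    by exists a, b.
  have [k kB kE] := lift_pi_char_open cc' Bu' Bw'.
  by exists k => //; rewrite kE lift_recenter.
Qed.

(* The image of what the disk has outside [O] is compact, and misses the image of
   the inside because the boundary of a cell lies in cells of lower dimension. *)
Lemma pi_char_open x (O : set 'rV[R]_(pi_dim x)) : open O -> exists2 V : set (Pi R X), open V &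
  @pi_char x @` (O `&` open_disk R (pi_dim x)) =
  V `&` (@pi_char x @` open_disk R (pi_dim x)).
Proof.
move=> oO; exists (~` (@pi_char x @` (closed_disk R (pi_dim x) `&` ~` O))).
  apply: closed_openC; apply: compact_closed; first exact: Pi_hausdorff.
  apply: cont_on_compact; first by apply: cont_onS (@pi_char_cont x) => ? [].
  by apply: compact_closedI; [exact: closed_disk_compact|exact: open_closedC].
apply/seteqP; split.
  move=> _ [v [Ov vB] <-]; split; last by exists v.
  move=> [w [wD nOw] wv]; apply: nOw; suff -> : w = v by [].
  have [wB|wS] := closed_disk_cases wD; first by apply: pi_char_inj; rewrite ?in_setE.
  have [F [_ dF bF]] := pi_closure_finite x.
  have [y Fy yw] := bF (pi_char w) (ex_intro2 _ _ w wS erefl).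
  have [x' [_ x'u]] := pi_partition (pi_char w).
  have xv : (@pi_char x @` open_disk R (pi_dim x)) (pi_char w).
    by rewrite wv; exists v.
  have xy : x = y := etrans (esym (x'u x xv)) (x'u y yw).
  by have := dF _ Fy; rewrite -xy ltnn.
move=> z [nO [v vB vz]]; exists v => //; split => //.
apply: contrapT => nOv; apply: nO; exists v => //; split => //.
exact: open_disk_closed_disk.
Qed.

(** [m] is the section of the pair of end maps with values in the sheet through [z]. The set [O]
    where it avoids [A] is open by [cw_prod_coherent], since over a product of cells the section
    locally agrees with a lifted cell. *)
Lemma pi_weak_topology (A : set (Pi R X)) :
  (forall x, closed (A `&` (@pi_char x @` closed_disk R (pi_dim x)))) -> closed A.
Proof.
move=> cA; rewrite -openC openE => z nAz; rewrite /interior.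
have [U [nU Uz _]] := nbX (x := psrc z) (O := setT) filterT.
have [V [nV Vz _]] := nbX (x := ptgt z) (O := setT) filterT.
pose m (p : X * X) := pconj (plocal U p.1 (psrc z)) z (plocal V (ptgt z) p.2).
pose O := [set p : X * X | [/\ U p.1, V p.2 & ~ A (m p)]].
have oO : open O.
  apply: (cw_prod_coherent cC) => e f u0 w0 Du0 Dw0 [/= Uu0 Vw0 nA].
  have cc : centered e f (recenter u0 w0 (m (cw_char e u0, cw_char f w0))).
    by apply: centered_recenter => //; rewrite /m ?psrc_conj ?ptgt_conj
      ?psrc_local ?ptgt_local.
  set c := recenter _ _ _ in cc.
  have l0 : cell_lift c u0 w0 = m (cw_char e u0, cw_char f w0).
    by rewrite lift_recenter// /m ?psrc_conj ?ptgt_conj ?psrc_local ?ptgt_local.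
  have cl := closed_openC (cA (mk_cell cc)).
  have nu := near_eseg Du0 nU Uu0; have nw := near_eseg Dw0 nV Vw0.
  have : nbhs (cell_lift c u0 w0) (~` (A `&` (@pi_char (mk_cell cc) @` closed_disk R _))).
    by apply: open_nbhs_nbhs; split => //; rewrite l0 => -[].
  move=> /(@lift_cont_on _ _ _ nbX _ _ _ cc (u0, w0) (conj Du0 Dw0)) nl.
  have nu' : \forall p \near (u0, w0), _ := @cvg_fst _ _ (nbhs u0) (nbhs w0) (nbhs_filter w0) _ nu.
  have nw' : \forall p \near (u0, w0), _ := @cvg_snd _ _ (nbhs u0) (nbhs w0) (nbhs_filter u0) _ nw.
  move: nl nu' nw'; apply: filterS3 => -[u w] /= hl hu hw Du Dw.
  have [Uu us _] := hu Du; have [Vw _ ws] := hw Dw; split => //= Amu.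
  apply: (hl (conj Du Dw)); split; last by have [v] := lift_pi_char cc Du Dw; exists v.
  rewrite -(lift_move cc Du0 Du Dw0 Dw) l0 us ws /m.
  by rewrite pconj_conj ?psrc_local ?ptgt_local// !plocal_mul.
have nO : nbhs (psrc z, ptgt z) O.
  by apply: open_nbhs_nbhs; split => //; split => //=; rewrite /m /= !plocal_id// pconj1.
have nS := nbhs_sheet nU nV Uz Vz.
have nO' : \forall y \near z, O (psrc y, ptgt y).
  have [[P Q] /= [nP nQ] PQO] := nO.
  have n1 : \forall y \near z, P (psrc y) := psrc_continuous nbX nP.
  have n2 : \forall y \near z, Q (ptgt y) := ptgt_continuous nbX nQ.
  by move: n1 n2; apply: filterS2 => y Py Qy; apply: PQO.
move: nS nO'; apply: filterS2 => y [_ _ yE] [_ _]; rewrite /m /=.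
by rewrite -yE.
Qed.

Definition pi_cw : cw_complex R (Pi R X) := @CWComplex R (Pi R X) pi_cell pi_dim pi_char
  (Pi_hausdorff nbX hX) (fun x => (cont_onP _ _).2 (@pi_char_cont x))
  pi_char_inj pi_char_open pi_partition pi_closure_finite pi_weak_topology.

End PiCW.

(** * Local finiteness and countability *)

Section LocallyFinite.
Context {R : realType} {X : topologicalType} (C : cw_complex R X).
Hypothesis cC : cw_countable C.
Local Notation D e := (closed_disk R (cw_dim e)).

Let nbX : @nice_basis R X := countable_cw_nice_basis cC.
Let hX : hausdorff_space X := cw_hausdorff C.

Lemma near_finite_cells (T : Type) (F : set_system T) {FF : Filter F}
    (E : set (cw_cell C)) (P : cw_cell C -> T -> Prop) : finite_set E ->
  (forall e, E e -> \forall x \near F, P e x) ->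
  \forall x \near F, forall e, E e -> P e x.
Proof.
have [ord [oi _]] := countable_cw_order cC.
move=> /(finite_set_bounded ord)[n En] EP.
have : \forall x \near F, forall i, (i < n)%N -> forall e, E e -> ord e = i -> P e x.
  apply: (@near_forall_lt _ F _ (fun i x => forall e, E e -> ord e = i -> P e x)) => i.
  have [[e [Ee ei]]|ne] := pselect (exists e, E e /\ ord e = i).
    apply: filterS (EP e Ee) => x Px e' _ e'i.
    by have -> : e' = e by apply: oi; rewrite e'i.
  by apply: filterE => x e Ee ei; exfalso; apply: ne; exists e.
by apply: filterS => x h e Ee; exact: h (En e Ee) e Ee erefl.
Qed.

Definition fiber_left (e : cw_cell C) (x : X) : set (Pi R X) :=
  [set a | exists u, [/\ D e u, cw_char e u = x & a = eseg 0 u]].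

Definition fiber_right (e : cw_cell C) (x : X) : set (Pi R X) :=
  [set a | exists u, [/\ D e u, cw_char e u = x & a = eseg u 0]].

(** Fix a preimage [v] of [x] in the open cell through [x]. Each class of the fiber is a gluing
    class through [x] followed by the segment from the center to [v]. *)
Lemma finite_fiber_left e x : finite_set (fiber_left e x).
Proof.
have [e' [v Bv vx]] := open_cellP C x; have Dv := open_disk_closed_disk Bv.
apply: (@sub_finite_set _ _ ((fun a => pmul a (eseg 0 v)) @` cell_glue e' e)); last first.
  by apply: finite_image; exact: finite_glue.
move=> _ [u [Du ux ->]]; exists (pmul (eseg 0 u) (eseg v 0)).
  by exists v, u; split => //; rewrite ux vx.
have D0 n : closed_disk R n 0 := @closed_disk0 R n.
rewrite pmulA ?psrc_eseg ?ptgt_eseg ?ux ?vx// eseg_mul// eseg_id pmul1r//.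
by rewrite ptgt_eseg// ux vx.
Qed.

Lemma finite_fiber_right e x : finite_set (fiber_right e x).
Proof.
have [e' [v Bv vx]] := open_cellP C x; have Dv := open_disk_closed_disk Bv.
apply: (@sub_finite_set _ _ ((fun a => pmul (eseg v 0) a) @` cell_glue e e')); last first.
  by apply: finite_image; exact: finite_glue.
move=> _ [u [Du ux ->]]; exists (pmul (eseg 0 v) (eseg u 0)).
  by exists u, v; split => //; rewrite ux vx.
have D0 n : closed_disk R n 0 := @closed_disk0 R n.
rewrite -pmulA ?psrc_eseg ?ptgt_eseg ?ux ?vx// eseg_mul// eseg_id pmul1l//.
by rewrite psrc_eseg// ux vx.
Qed.

(** By compactness of the disk, each preimage [u] of [y] is close to a preimage [u0] of [x]; the
    segment to [u] continued by the short path from [y] to [x] is the segment to [u0]. *)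
Lemma near_fiber (e : cw_cell C) (U : set X) x : nice R U -> U x ->
  \forall y \near x, forall u, D e u -> cw_char e u = y -> U y /\
    (fiber_left e x (pmul (eseg 0 u) (plocal U y x)) /\
     fiber_right e x (pmul (plocal U x y) (eseg u 0))).
Proof.
move=> nU Ux; pose P u := U (cw_char e u) /\
    (fiber_left e x (pmul (eseg 0 u) (plocal U (cw_char e u) x)) /\
     fiber_right e x (pmul (plocal U x (cw_char e u)) (eseg u 0))).
have : \forall y \near x, forall u, D e u -> cw_char e u = y -> P u.
  apply: compact_fiber_near => //; [exact: closed_disk_compact|exact: cw_char_cont_on|].
  move=> u0 Du0 u0x; have Uu0 : U (cw_char e u0) by rewrite u0x.
  have D0 : D e 0 := @closed_disk0 R _.
  apply: filterS (near_eseg Du0 nU Uu0) => u hu Du; have [Uu us su] := hu Du.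
  split => //; split; exists u0; split => //; rewrite -u0x.
    by rewrite -us eseg_mul.
  by rewrite -su eseg_mul.
by apply: filterS => y h u Du uy; have := h u Du uy; rewrite /P uy.
Qed.

(** If a lifted cell meets the neighborhood at [y], then [y] is [z] prolonged by short paths.
    Absorbing these by [near_fiber] writes the center as [z] composed with a fiber class at each
    end. *)
Lemma pi_cw_locally_finite : cw_locally_finite C -> cw_locally_finite (pi_cw cC).
Proof.
move=> lfC z.
have [Ux nUx fEx] := lfC (psrc z); have [Uy nUy fEy] := lfC (ptgt z).
set Ex := [set e | _] in fEx; set Ey := [set e | _] in fEy.
have [U [nU Uz _]] := nbX (x := psrc z) (O := setT) filterT.
have [V [nV Vz _]] := nbX (x := ptgt z) (O := setT) filterT.
have n1 := near_finite_cells (FF := nbhs_filter (psrc z)) fEx (fun e _ => near_fiber e nU Uz).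
have n2 := near_finite_cells (FF := nbhs_filter (ptgt z)) fEy (fun e _ => near_fiber e nV Vz).
have m1 : \forall y \near z, _ :=
  psrc_continuous nbX (@filterI _ _ (nbhs_filter (psrc z)) _ _ nUx n1).
have m2 : \forall y \near z, _ :=
  ptgt_continuous nbX (@filterI _ _ (nbhs_filter (ptgt z)) _ _ nUy n2).
have m3 := nbhs_sheet nU nV Uz Vz.
exists (psheet U V z `&` (psrc @^-1` (Ux `&` [set y | forall e, Ex e ->
    forall u, D e u -> cw_char e u = y -> U y /\
    (fiber_left e (psrc z) (pmul (eseg 0 u) (plocal U y (psrc z))) /\
     fiber_right e (psrc z) (pmul (plocal U (psrc z) y) (eseg u 0)))]) `&`
   ptgt @^-1` (Uy `&` [set y | forall e, Ey e ->
    forall u, D e u -> cw_char e u = y -> V y /\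
    (fiber_left e (ptgt z) (pmul (eseg 0 u) (plocal V y (ptgt z))) /\
     fiber_right e (ptgt z) (pmul (plocal V (ptgt z) y) (eseg u 0)))]))).
  by apply: filterI => //; exact: filterI.
apply: sub_finite_set (@finite_pi_cells _ _ C Ex Ey (fun e => fiber_left e (psrc z))
  (fun e => fiber_right e (ptgt z)) z fEx fEy (fun e _ => finite_fiber_left e _)
  (fun e _ => finite_fiber_right e _)).
move=> [[[e f] c] cc] [y [[v vD vy] [[Us Vt yE] [[Uxy hx] [Uyy hy]]]]].
have [Dl Dr] := (hmap_closed v).1 vD.
have sy := psrc_pi_char vD; have ty := ptgt_pi_char vD.
rewrite [pi_char _]vy in sy; rewrite [pi_char _]vy in ty.
rewrite /pi_left /pi_right /= in sy ty Dl Dr *.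
have Exe : Ex e by exists (psrc y); split => //; rewrite sy; exists (hleft v).
have Eyf : Ey f by exists (ptgt y); split => //; rewrite ty; exists (hright v).
split => //.
have [_ [fl _]] := hx e Exe _ Dl (esym sy).
have [_ [_ fr]] := hy f Eyf _ Dr (esym ty).
exists (pmul (eseg 0 (hleft v)) (plocal U (psrc y) (psrc z))),
  (pmul (plocal V (ptgt z) (ptgt y)) (eseg (hright v) 0)); split => //.
have D0 n : closed_disk R n 0 := @closed_disk0 R n.
have ce : recenter (hleft v) (hright v) y = c by rewrite -vy; exact: recenter_lift.
apply: (etrans (esym ce)); rewrite /recenter [in LHS]yE.
by rewrite pconj_conj ?psrc_local ?ptgt_local ?psrc_eseg ?ptgt_eseg.
Qed.

End LocallyFinite.

Section CountableCells.
Context {R : realType} {X : topologicalType} (C : cw_complex R X).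
Hypothesis cC : cw_countable C.
Local Notation D e := (closed_disk R (cw_dim e)).
Local Notation I := (@unit_itv R).

Let nbX : @nice_basis R X := countable_cw_nice_basis cC.
Let D0 n : closed_disk R n 0 := @closed_disk0 R n.

(** Products of nesting depth at most [n]. The factors need not be composable, which does not affect
    countability. *)
Fixpoint cell_words (n : nat) : set (Pi R X) :=
  if n is m.+1 then cell_words m `|`
    (fun p : Pi R X * Pi R X => pmul p.1 p.2) @` (cell_words m `*` cell_words m)
  else [set pid (cw_char e 0) | e in [set: cw_cell C]] `|`
    \bigcup_(p in [set: cw_cell C * cw_cell C]) cell_glue p.1 p.2.

Definition cell_word := \bigcup_n cell_words n.

Lemma countable_image (S T : Type) (f : S -> T) (A : set S) :
  countable A -> countable (f @` A).
Proof. by move=> cA; apply: sub_countable cA; exact: card_image_le. Qed.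

Lemma countable_setU (T : Type) (A B : set T) :
  countable A -> countable B -> countable (A `|` B).
Proof.
move=> cA cB; rewrite (_ : A `|` B = \bigcup_(b in [set: bool]) if b then A else B).
  by apply: bigcup_countable => [|[]//]; exact: countableP.
by apply/seteqP; split => [x [Ax|Bx]|x [[] _]]; [exists true|exists false|left|right].
Qed.

Lemma countable_cell_word : countable cell_word.
Proof.
apply: bigcup_countable => [|n _]; first exact: countableP.
elim: n => [|n IH] /=.
  apply: countable_setU; first exact: countable_image.
  apply: bigcup_countable.
    by rewrite -setXTT; exact: countableX.
  by move=> p _; apply: finite_set_countable; exact: finite_glue.
by apply: countable_setU => //; apply: countable_image; exact: countableX.
Qed.

Lemma cell_wordsS m n : (m <= n)%N -> cell_words m `<=` cell_words n.
Proof.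
elim: n => [|n IH]; first by rewrite leqn0 => /eqP ->.
by rewrite leq_eqVlt => /orP[/eqP ->//|]; rewrite ltnS => /IH mn z /mn; left.
Qed.

Lemma cell_word_mul a b : cell_word a -> cell_word b -> cell_word (pmul a b).
Proof.
move=> [m _ am] [n _ bn]; exists (maxn m n).+1 => //; right; exists (a, b) => //.
by split; [exact: (cell_wordsS (leq_maxl m n))|exact: (cell_wordsS (leq_maxr m n))].
Qed.

Lemma cell_word_id (e : cw_cell C) : cell_word (pid (cw_char e 0)).
Proof. by exists 0%N => //; left; exists e. Qed.

Lemma cell_word_glue (e f : cw_cell C) a : cell_glue e f a -> cell_word a.
Proof. by move=> ga; exists 0%N => //; right; exists (e, f). Qed.

(** The cells and the preimages of the ends are existentially quantified; by [word_classP] any other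
    choice gives the same answer. *)
Definition word_class : set (Pi R X) := [set z | exists e f u w,
  [/\ D e u, D f w, psrc z = cw_char e u, ptgt z = cw_char f w &
      cell_word (@recenter _ _ C e f u w z)]].

(** Two recenterings of [z] differ by gluing classes at the ends, and words are stable under
    products. *)
Lemma word_classP z e f u w : word_class z -> D e u -> D f w ->
  psrc z = cw_char e u -> ptgt z = cw_char f w -> cell_word (@recenter _ _ C e f u w z).
Proof.
move=> [e' [f' [u' [w' [Du' Dw' sz' tz' wz]]]]] Du Dw sz tz.
have cc := centered_recenter Du' Dw' sz' tz'.
have [||a [b [ga gb]]] := recenter_lift_glue cc Du' Dw' Du Dw; rewrite -?sz' -?tz'//.
rewrite lift_recenter// => ->.
exact: (cell_word_mul (cell_word_mul (cell_word_glue ga) wz) (cell_word_glue gb)).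
Qed.

Lemma word_class_lift x v : closed_disk R (pi_dim x) v ->
  word_class (@pi_char _ _ C x v) <-> cell_word (pi_center x).
Proof.
move=> vD; have [Dl Dr] := (hmap_closed v).1 vD.
have e : recenter (hleft v) (hright v) (pi_char v) = pi_center x.
  by apply: recenter_lift => //; exact: pi_centered.
split => [wz|wc].
  by rewrite -e; apply: word_classP => //; [exact: psrc_pi_char|exact: ptgt_pi_char].
exists (pi_left x), (pi_right x), (hleft v), (hright v).
by split; rewrite ?e//; [exact: psrc_pi_char|exact: ptgt_pi_char].
Qed.

(** By [word_class_lift] a closed lifted cell lies inside [word_class] or misses it, so the weak
    topology settles this set, and likewise its complement. *)
Lemma word_class_closed : closed word_class.
Proof.
apply: (cw_weak_topology (c := pi_cw cC)) => x.
have cx : closed (closed_cell (C := pi_cw cC) x) := @closed_cell_closed _ _ _ x.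
have [wc|nwc] := pselect (cell_word (pi_center x)).
  rewrite (_ : _ `&` _ = closed_cell (C := pi_cw cC) x)//.
  apply/seteqP; split => z; first by move=> [].
  move=> [v vD vz]; split; last by exists v.
  by rewrite -vz; apply/word_class_lift.
rewrite (_ : _ `&` _ = set0); first exact: closed0.
apply/seteqP; split => z // -[wz [v vD vz]].
by apply: nwc; apply/(word_class_lift vD); rewrite [pi_char _]vz.
Qed.

Lemma word_class_open : open word_class.
Proof.
rewrite -closedC; apply: (cw_weak_topology (c := pi_cw cC)) => x.
have cx : closed (closed_cell (C := pi_cw cC) x) := @closed_cell_closed _ _ _ x.
have [wc|nwc] := pselect (cell_word (pi_center x)); last first.
  rewrite (_ : _ `&` _ = closed_cell (C := pi_cw cC) x)//.
  apply/seteqP; split => z; first by move=> [].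
  move=> [v vD vz]; split; last by exists v.
  by rewrite -vz => /(word_class_lift vD) h; exact: nwc h.
rewrite (_ : _ `&` _ = set0); first exact: closed0.
apply/seteqP; split => z // -[nwz [v vD vz]].
by apply: nwz; rewrite -vz; apply/word_class_lift.
Qed.

Lemma pseg_cont_on (g : R -> X) : is_path g ->
  cont_on I (fun t : R => pseg (g : R^o -> X) 0 t).
Proof.
move=> pg t0 It0 N.
have cI := @convex_unit_itv R; have cg := is_path_cont_on pg.
have I0 : I 0 := unit_itv0.
move=> /(nbhs_PiP nbX)[U [V [nU nV Us Vt UVN]]].
have st t : I t -> psrc (pseg (g : R^o -> X) 0 t) = g 0.
  by move=> It; rewrite (psrc_seg cI cg).
have tt t : I t -> ptgt (pseg (g : R^o -> X) 0 t) = g t.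
  by move=> It; rewrite (ptgt_seg cI cg).
rewrite st// in Us; rewrite tt// in Vt.
have := near_seg cI cg It0 nV Vt; apply: filterS => t ht It.
have [Vgt _ e] := ht It; apply: UVN; split; rewrite ?st ?tt//.
by rewrite plocal_id// -e /pconj pmul1l ?st// (pmul_seg cI cg).
Qed.

(* A class is joined in Pi(X) to an identity by its initial segments. *)
Lemma word_classT z : word_class z.
Proof.
have cI := @convex_unit_itv R; have cg := is_path_cont_on (prep_path z).
pose c (t : R) := pseg (prep z : R^o -> X) 0 t.
have cc : cont_on I c := pseg_cont_on (prep_path z).
have I0 : I 0 := unit_itv0; have I1 : I 1 := unit_itv1.
have c0 : c 0 = pid (psrc z) by rewrite /c psegaa.
have c1 : c 1 = z by rewrite /c -pcls_seg// prepK.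
have clI : closed I by exact: interval_closed.
suff h : I `&` c @^-1` word_class = I.
  have : (I `&` c @^-1` word_class) 1 by rewrite h.
  by case => _; rewrite /= c1.
have conI : connected I by exact: segment_connected.
apply: conI.
- exists 0; split => //=; rewrite c0.
  (* An identity, recentered with the same cell and preimage at both ends, becomes the identity at
     the center. *)
  have [e [u Bu ue]] := open_cellP C (psrc z); have Du := open_disk_closed_disk Bu.
  exists e, e, u, u; split; rewrite ?psrc_id ?ptgt_id//.
  rewrite /recenter /pconj pmul1r ?ptgt_eseg// eseg_mul// eseg_id.
  exact: cell_word_id.
- exists (~` (I `&` c @^-1` (~` word_class))).
    apply: closed_openC; apply: cont_on_closed => //.
    by apply: open_closedC; exact: word_class_open.
  apply/seteqP; split => t [It]; first by move=> wt; split => // -[_].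
  by move=> nt; split => //; apply: contrapT => nwt; apply: nt.
- exists (I `&` c @^-1` word_class).
    by apply: cont_on_closed => //; exact: word_class_closed.
  by rewrite setIA setIid.
Qed.

Lemma pi_cw_countable : cw_countable (pi_cw cC).
Proof.
have : countable (([set: cw_cell C] `*` [set: cw_cell C]) `*` cell_word).
  by apply: countableX; [exact: countableX|exact: countable_cell_word].
move=> /pcard_injP[k kinj]; apply/pcard_injP.
have word x : cell_word (pi_center (C := C) x).
  apply/(@word_class_lift x 0); [exact: D0|exact: word_classT].
exists (k \o (fun x : pi_cell C => sval x)) => x y _ _ /= kxy.
apply: pi_cell_inj; apply: kinj => //; apply: mem_set; split => //; exact: word.
Qed.

End CountableCells.

(* The cells that can be reached from a given one through a chain of meeting
   cells are countably many, and their union is open and closed. *)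
Lemma connected_locally_finite_countable (R : realType) (X : topologicalType)
  (C : cw_complex R X) : connected [set: X] -> cw_locally_finite C -> cw_countable C.
Proof.
move=> conX lfC; rewrite /cw_countable.
have [e0|nC] := pselect (exists e : cw_cell C, True); last first.
  rewrite (_ : [set: _] = set0); first exact: countable0.
  by apply/seteqP; split => e // _; exfalso; apply: nC; exists e.
case: e0 => e0 _.
pose nbr (e : cw_cell C) := [set e' : cw_cell C | closed_cell e' `&` closed_cell e !=set0].
(* A closed cell is compact, and each of its points has a neighborhood meeting finitely many closed
   cells. *)
have fnbr e : finite_set (nbr e).
  have : finite_set (\bigcup_(x in closed_cell e) [set e' : cw_cell C | closed_cell e' x]).
    apply: compact_bigcup_finite; first exact: closed_cell_compact.
    move=> x _; have [U xU fU] := lfC x; exists [set e' : cw_cell C | closed_cell e' `&` U !=set0].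
    split => //; apply: filterS xU => y Uy _ e' /= ye'; by exists y.
  by apply: sub_finite_set => e' [x [xe' xe]]; exists x.
pose N := fix N k := if k is k'.+1 then \bigcup_(e in N k') nbr e else [set e0].
have cN k : countable (N k).
  elim: k => [|k IH]; first exact: countable1.
  by apply: bigcup_countable => // e _; exact: finite_set_countable.
pose M := \bigcup_k N k.
have MM e e' : M e -> nbr e e' -> M e'.
  by move=> [k _ Ne] ee'; exists k.+1 => //; exists e.
(* A closed cell lies inside the union or misses it, according to whether it belongs to [S]. *)
have meet (S : set (cw_cell C)) : (forall e e', S e -> nbr e e' -> S e') ->
    closed (\bigcup_(e in S) closed_cell e).
  move=> SS; apply: (cw_weak_topology (c := C)) => e; rewrite -/(closed_cell e).
  have [Se|nSe] := pselect (S e).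
    rewrite (_ : _ `&` _ = closed_cell e); first exact: closed_cell_closed.
    by apply/seteqP; split => x; [move=> []|move=> xe; split => //; exists e].
  rewrite (_ : _ `&` _ = set0); first exact: closed0.
  apply/seteqP; split => x // -[[e' Se' xe'] xe]; apply: nSe.
  by apply: (SS e' e Se'); exists x.
have MT : \bigcup_(e in M) closed_cell e = [set: X].
  apply: conX.
  - exists (cw_char e0 0), e0; first by exists 0%N.
    by exists 0 => //; exact: closed_disk0.
  (* Meeting is symmetric, so the complement of [M] is stable too, and the two unions are
     complementary. *)
  - exists (~` \bigcup_(e in ~` M) closed_cell e).
      apply: closed_openC; apply: meet => e e' nMe ee' Me'; apply: nMe.
      by apply: (MM e' e Me'); move: ee'; rewrite /nbr /= setIC.
    rewrite setTI; apply/seteqP; split => x.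
      move=> [e Me xe] [e' nMe' xe']; apply: nMe'.
      by apply: (MM e e' Me); exists x.
    move=> nx; have [e xe] := open_cellP C x; exists e; last exact: open_cell_sub.
    by apply: contrapT => nMe; apply: nx; exists e => //; exact: open_cell_sub.
  - by exists (\bigcup_(e in M) closed_cell e); [exact: meet|rewrite setTI].
have -> : [set: cw_cell C] = M.
  apply/seteqP; split => // e _.
  have : [set: X] (cw_char e 0) by [].
  rewrite -MT => -[e' Me' e'0]; apply: (MM e' e Me'); exists (cw_char e 0).
  by split => //; exists 0 => //; exact: closed_disk0.
by apply: bigcup_countable => [|k _]; [exact: countableP|exact: cN].
Qed.

Theorem proposition3p5 (R : realType) (X : topologicalType)
    (C : cw_complex R X) (hX : connected [set: X]) :
  (cw_locally_finite C ->
     exists D : cw_complex R (Pi R X), cw_locally_finite D) /\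
  (cw_countable C ->
     exists D : cw_complex R (Pi R X), cw_countable D).
Proof.
split=> [lfC|cC].
  exists (pi_cw (connected_locally_finite_countable hX lfC)).
  exact: pi_cw_locally_finite.
by exists (pi_cw cC); exact: pi_cw_countable.
Qed.
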